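(* Let $\alpha\neq0$ be a real constant and $\Omega=\{(x,t):x\in\mathbb{R},\ t>0\}$. Let $u_0=(u_0^\epsilon)_{0<\epsilon<1}$ and $v_0=(v_0^\epsilon)_{0<\epsilon<1}$ be in $\mathcal{G}(\mathbb{R})$, where $u_0^\epsilon$ and $v_0^\epsilon$ are bounded $C^\infty$ functions on $\mathbb{R}$ satisfying, for $j=0,1,2,\dots$, $$\|\partial_x^ju_0^\epsilon\|_{L^\infty(\mathbb{R})}=O(\epsilon^{-j}),\qquad \|\partial_x^jv_0^\epsilon\|_{L^\infty(\mathbb{R})}=O(\epsilon^{-j})\qquad(\epsilon\to0),$$ and such that $u_0^\epsilon$ and $v_0^\epsilon$ converge pointwise almost everywhere on $\mathbb{R}$, as $\epsilon\to0$, to functions (again denoted $u_0(x)$ and $v_0(x)$). For $0<\epsilon<1$ let $$u^\epsilon(x,t)=e^{-\alpha t}\,\frac{\int_{\mathbb{R}}\frac{x-y}{\tau(t)}\,e^{-\theta^\epsilon(x,y,\tau(t))/(2\epsilon)}\,dy}{\int_{\mathbb{R}}e^{-\theta^\epsilon(x,y,\tau(t))/(2\epsilon)}\,dy},\qquad v^\epsilon=\partial_xV^\epsilon,\qquad V^\epsilon(x,t)=\frac{\int_{\mathbb{R}}\left(\int_0^yv_0^\epsilon(s)\,ds\right)e^{-\theta^\epsilon(x,y,\tau(t))/(2\epsilon)}\,dy}{\int_{\mathbb{R}}e^{-\theta^\epsilon(x,y,\tau(t))/(2\epsilon)}\,dy},$$ where $\tau(t)=\frac{1-e^{-\alpha t}}{\alpha}$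 and $\theta^\epsilon(x,y,\tau)=\frac{(x-y)^2}{2\tau}+\int_0^yu_0^\epsilon(s)\,ds$. Then $u=(u^\epsilon)_{0<\epsilon<1}$ and $v=(v^\epsilon)_{0<\epsilon<1}$ are in $\mathcal{G}(\Omega)$, and $(u,v)$ is a solution, in the sense of association, of $$u_t+\left(\tfrac{u^2}{2}\right)_x+\alpha u\approx0,\qquad v_t+(uv)_x\approx0$$ with initial condition $(u_0,v_0)=(u_0^\epsilon(x),v_0^\epsilon(x))_{0<\epsilon<1}$.
   Context: Colombeau algebra: let $\mathcal{E}(\Omega)=[C^\infty(\Omega)]^{(0,1)}$ be the set of families $w=(w^\epsilon)_{0<\epsilon<1}$ of $C^\infty$ functions on $\Omega$. A family $w$ is moderate if for every compact $K\subset\Omega$ and all nonnegative integers $j,\ell$ there is $N>0$ such that $\|\partial_t^j\partial_x^\ell w^\epsilon\|_{L^\infty(K)}=O(\epsilon^{-N})$ as $\epsilon\to0$. It is null if for every compact $K\subset\Omega$, all nonnegative integers $j,\ell$ and all $M>0$, $\|\partial_t^j\partial_x^\ell w^\epsilon\|_{L^\infty(K)}=O(\epsilon^M)$ as $\epsilon\to0$. Let $\mathcal{E}_M(\Omega)$ and $\mathcal{N}(\Omega)$ be the sets of moderate and null families; the algebra of generalized functions of Colombeau is the quotient $\mathcal{G}(\Omega)=\mathcal{E}_M(\Omega)/\mathcal{N}(\Omega)$, with algebraic operations and partial derivatives defined on representatives. $\mathcal{G}(\mathbb{R})$ is defined in the same way with $\mathbb{R}$ (variable $x$ only) in place of $\Omega$.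 A family is identified with its class. Association: $w_1,w_2\in\mathcal{G}(\Omega)$ are associated, written $w_1\approx w_2$, if for some (hence all) representatives, $w_1^\epsilon-w_2^\epsilon\to0$ in the sense of distributions on $\Omega$ as $\epsilon\to0$. A pair $(u,v)\in\mathcal{G}(\Omega)\times\mathcal{G}(\Omega)$ is a weak solution in the sense of association of the system if $u_t+(u^2/2)_x+\alpha u\approx0$ and $v_t+(uv)_x\approx0$. The initial condition means $u^\epsilon(x,0)=u_0^\epsilon(x)$ and $v^\epsilon(x,0)=v_0^\epsilon(x)$ for each $\epsilon$. *)

(* Defs.v *)
From HB Require Import structures.
From mathcomp Require Import all_boot all_order all_algebra.
From mathcomp Require Import all_classical all_reals all_analysis.
Set Implicit Arguments.
Unset Strict Implicit.
Unset Printing Implicit Defensive.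
Import Order.TTheory GRing.Theory Num.Theory.
Import numFieldNormedType.Exports.
Local Open Scope classical_set_scope.
Local Open Scope ring_scope.

(* Points of the plane are pairs p = (x, t). *)

Section Colombeau.
Context {R : realType}.
Implicit Types (f : R * R -> R) (U K : set (R * R)).

Definition Omega : set (R * R) := [set p | 0 < p.2].

Definition dx f : R * R -> R := fun p => derive1 (fun x => f (x, p.2)) p.1.
Definition dt f : R * R -> R := fun p => derive1 (fun t => f (p.1, t)) p.2.

Definition partially_derivable f (p : R * R) : Prop :=
  derivable (fun x => f (x, p.2)) p.1 1 /\ derivable (fun t => f (p.1, t)) p.2 1.

(* For U open: every mixed partial derivative of order at most k (in any order
   of differentiation) exists and is continuous at every point of U. *)
Fixpoint Ck U (k : nat) f : Prop :=
  (forall p, U p -> {for p, continuous f}) /\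
  if k is k'.+1 then
    [/\ forall p, U p -> partially_derivable f p, Ck U k' (dx f)
      & Ck U k' (dt f)]
  else True.

Definition Cinfty U f : Prop := forall k, Ck U k f.

Definition Cinfty1 (g : R -> R) : Prop :=
  forall n x, derivable (derive1n n g) x 1.

Definition mu2 := (@lebesgue_measure R \x @lebesgue_measure R)%E.

Definition Linfty_norm K f : \bar R :=
  'N[mu2]_+oo[EFin \o patch (fun=> 0%R) K f]%E.

Definition Linfty_norm1 (K : set R) (g : R -> R) : \bar R :=
  'N[@lebesgue_measure R]_+oo[EFin \o patch (fun=> 0%R) K g]%E.

(* n e = O(g e) as e -> 0+; n is [\bar R]-valued because a norm may be infinite
   for the e that are not small. *)
Definition bigO_at0 (n : R -> \bar R) (g : R -> R) : Prop :=
  exists C : R, \forall e \near 0^'+, (n e <= (C * g e)%:E)%E.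

(* Only the members w e with 0 < e < 1, and for [Cfamily] only their values on
   Omega, are relevant: the other values are ignored by the definitions. *)
Definition Cfamily := R -> R * R -> R.
Definition Cfamily1 := R -> R -> R.

Definition smooth_family (w : Cfamily) : Prop :=
  forall e : R, 0 < e < 1 -> Cinfty Omega (w e).

Definition moderate : set Cfamily := [set w | smooth_family w /\
  forall K, compact K -> K `<=` Omega -> forall j l : nat, exists2 N : R, 0 < N &
    bigO_at0 (fun e => Linfty_norm K (iter j dt (iter l dx (w e))))
          (fun e => e `^ (- N))].

Definition null_family : set Cfamily := [set w | smooth_family w /\
  forall K, compact K -> K `<=` Omega -> forall (j l : nat) (M : R), 0 < M ->
    bigO_at0 (fun e => Linfty_norm K (iter j dt (iter l dx (w e))))
          (fun e => e `^ M)].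

Definition moderate1 : set Cfamily1 := [set w |
  (forall e : R, 0 < e < 1 -> Cinfty1 (w e)) /\
  forall K : set R, compact K -> forall l : nat, exists2 N : R, 0 < N &
    bigO_at0 (fun e => Linfty_norm1 K (derive1n l (w e))) (fun e => e `^ (- N))].

(* The elements of the quotient of moderate families by null families are
   the cosets of moderate families. *)
Definition gclass (w : Cfamily) : set Cfamily := [set w + n | n in null_family].
Definition colombeau : set (set Cfamily) := [set gclass w | w in moderate].

(* Operations on classes, defined on representatives. *)
Definition glift1 (F : Cfamily -> Cfamily) (c : set Cfamily) : set Cfamily :=
  \bigcup_(w in c) gclass (F w).
Definition glift2 (F : Cfamily -> Cfamily -> Cfamily) (c d : set Cfamily) :
    set Cfamily :=
  \bigcup_(w in c) \bigcup_(z in d) gclass (F w z).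

Definition gzero : set Cfamily := gclass 0.
Definition gadd := glift2 (fun w z e p => w e p + z e p).
Definition gmul := glift2 (fun w z e p => w e p * z e p).
Definition gscale (a : R) := glift1 (fun w e p => a * w e p).
Definition gdx := glift1 (fun w e => dx (w e)).
Definition gdt := glift1 (fun w e => dt (w e)).

Definition test_function (phi : R * R -> R) : Prop :=
  [/\ Cinfty setT phi, compact (closure [set p | phi p != 0])
    & closure [set p | phi p != 0] `<=` Omega].

Definition cvg0_distributions (w : Cfamily) : Prop :=
  forall phi, test_function phi ->
    (\int[mu2]_(p in Omega) (w e p * phi p)) @[e --> 0^'+] --> (0 : R).

Definition associated (c d : set Cfamily) : Prop :=
  exists w z, [/\ c w, d z & cvg0_distributions (fun e p => w e p - z e p)].

Definition weak_solution (alpha : R) (u v : set Cfamily) : Prop :=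
  [/\ colombeau u, colombeau v,
      associated
        (gadd (gadd (gdt u) (gdx (gscale 2^-1 (gmul u u)))) (gscale alpha u))
        gzero
    & associated (gadd (gdt v) (gdx (gmul u v))) gzero].

(* Members of a Cfamily are functions on the open half-plane, so their value at
   t = 0 is that of the continuous extension to the closed half-plane. *)
Definition initial_condition (w : Cfamily) (w0 : Cfamily1) : Prop :=
  forall e : R, 0 < e < 1 -> forall x : R,
    w e p @[p --> within Omega (nbhs (x, 0 : R))] --> w0 e x.

(* The oriented integral from 0 to y. *)
Definition primitive0 (g : R -> R) (y : R) : R :=
  if 0 <= y then \int[lebesgue_measure]_(s in `[0, y]) g s
  else - \int[lebesgue_measure]_(s in `[y, 0]) g s.

Definition tau (alpha t : R) : R := (1 - expR (- alpha * t)) / alpha.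

Definition theta (u0 : Cfamily1) (e x y s : R) : R :=
  (x - y) ^+ 2 / (2 * s) + primitive0 (u0 e) y.

Definition weight (alpha : R) (u0 : Cfamily1) (e : R) (p : R * R) (y : R) : R :=
  expR (- theta u0 e p.1 y (tau alpha p.2) / (2 * e)).

Definition usol (alpha : R) (u0 : Cfamily1) : Cfamily := fun e p =>
  expR (- alpha * p.2) *
  ((\int[lebesgue_measure]_y
      ((p.1 - y) / tau alpha p.2 * weight alpha u0 e p y)) /
   (\int[lebesgue_measure]_y weight alpha u0 e p y)).

Definition Vsol (alpha : R) (u0 v0 : Cfamily1) : Cfamily := fun e p =>
  (\int[lebesgue_measure]_y
     (primitive0 (v0 e) y * weight alpha u0 e p y)) /
  (\int[lebesgue_measure]_y weight alpha u0 e p y).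

Definition vsol (alpha : R) (u0 v0 : Cfamily1) : Cfamily :=
  fun e => dx (Vsol alpha u0 v0 e).

End Colombeau.

Arguments Cfamily : clear implicits.
Arguments Cfamily1 : clear implicits.

(* Main.v *)
Require Import Defs.
From mathcomp Require Import all_boot all_order all_algebra.
From mathcomp Require Import all_classical all_reals all_analysis.
From mathcomp Require Import measurable_realfun ess_sup_inf.
From mathcomp Require Import lebesgue_integral_under ring lra.
Import Order.TTheory GRing.Theory Num.Theory.
Import numFieldNormedType.Exports.
Local Open Scope classical_set_scope.
Local Open Scope ring_scope.

Set Implicit Arguments.
Unset Strict Implicit.
Unset Printing Implicit Defensive.

(** Write E for the mean with respect to the probability density proportional
    to exp(-theta(x,y,tau)/(2 eps)) in y. Then u = exp(-alpha t) (x - E[y])/tau,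
    V = E[p] with p the primitive of v0, and differentiating a mean E[y^k p^i]
    in x or t gives a polynomial in such means, 1/tau, exp(-alpha t), 1/eps and
    x. Integration by parts in y bounds the moments of y - x locally uniformly
    in (x,t) and eps, which gives moderateness. The algebra of these polynomials
    also shows that the left-hand sides of the two equations are exactly
    eps exp(-alpha t) u_xx and eps exp(-alpha t) V_xxx. Moving the derivatives
    to the test function, both tend to 0 because u and V are locally bounded
    uniformly in eps. Finally integration by parts gives u = exp(-alpha t) E[u0] and
    v = E[v0] + (E[p] E[u0] - E[p u0])/(2 eps), and E concentrates at x as
    t -> 0, which gives the initial values. *)

(** * Gaussian integrals of functions of exponential growth *)

(** Up to a factor that depends on t only, the common denominator W solves the heat equation W_tau =
    eps W_xx, and exp(alpha t) u is its Hopf-Cole transform -2 eps W_x / W. Since V is a quotient of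
    two such solutions, V_t + u V_x = eps exp(-alpha t) V_xx, and the equation for v is the
    x-derivative of this one. The obstacle is that v may be as large as 1/eps, so the product uv
    cannot be estimated uniformly. The exact identities avoid this: only u and V are ever paired
    with derivatives of the test function. Their bounds rest on a cancellation: the factor exp(-P/(2
    eps)) of the weight, P being the primitive of u0, has a logarithmic derivative of size M/(2
    eps), while the Gaussian factor has rate s = 1/(4 eps tau), and the moments see only the
    quotient (M/(2 eps))/(2 s) = M tau. Smoothness and moderateness concern mixed derivatives of
    every order. A syntax of expressions closed under both derivatives reduces them to one
    continuity lemma and one bound, both valid for all expressions. *)

Section ExpGrowth.
Context {R : realType}.
Implicit Types q f : R -> R.

(** The class has to contain [hopf], which can grow like exp(K |y|), and to be an algebra, so that
    products with powers and primitives stay inside; Gaussian decay still beats it. *)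
Definition exp_growth q :=
  continuous q /\ exists2 K, 0 <= K & forall y, `|q y| <= expR (K * (1 + `|y|)).

Lemma exp_growth_of_lin f K : continuous f ->
  (forall y, `|f y| <= K * (1 + `|y|)) -> exp_growth f.
Proof.
move=> cf fK; have K0 : 0 <= K.
  by have := fK 0; rewrite normr0 addr0 mulr1; apply: le_trans.
split=> //; exists K => // y; apply: (le_trans (fK y)).
by have := expR_ge1Dx (K * (1 + `|y|)); lra.
Qed.

Lemma exp_growth_cst (c : R) : exp_growth (fun=> c).
Proof.
apply: (@exp_growth_of_lin _ `|c|); first by move=> x; exact: cvg_cst.
by move=> y; rewrite ler_peMr// lerDl.
Qed.

Lemma exp_growth_id : exp_growth id.
Proof.
apply: (@exp_growth_of_lin _ 1); first by move=> x; exact: cvg_id.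
by move=> y; rewrite mul1r lerDr.
Qed.

Lemma exp_growthM q f : exp_growth q -> exp_growth f ->
  exp_growth (fun y => q y * f y).
Proof.
move=> [cq [K K0 qK]] [cf [L L0 fL]]; split.
  by move=> x; apply: cvgM; [exact: cq|exact: cf].
exists (K + L); first exact: addr_ge0.
by move=> y; rewrite normrM mulrDl expRD ler_pM.
Qed.

Lemma exp_growthD q f : exp_growth q -> exp_growth f ->
  exp_growth (fun y => q y + f y).
Proof.
move=> [cq [K K0 qK]] [cf [L L0 fL]]; split.
  by move=> x; apply: cvgD; [exact: cq|exact: cf].
(* The extra 1 pays for the factor 2 in a + b <= 2ab, valid for a, b >= 1, because exp(1 + |y|) >=
   2. *)
exists (K + L + 1); first lra.
move=> y; apply: (le_trans (ler_normD _ _)); apply: (le_trans (lerD (qK y) (fL y))).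
rewrite !mulrDl !expRD mul1r.
have y0 : 0 <= 1 + `|y| by rewrite addr_ge0.
have a1 : 1 <= expR (K * (1 + `|y|)) by rewrite -expR0 ler_expR mulr_ge0.
have b1 : 1 <= expR (L * (1 + `|y|)) by rewrite -expR0 ler_expR mulr_ge0.
have c1 : 2 <= expR (1 + `|y|).
  by have := expR_ge1Dx (1 + `|y|); have := normr_ge0 y; lra.
move: a1 b1 c1.
set a := expR (K * _); set b := expR (L * _); set c := expR _ => a1 b1 c1.
have ab : a + b <= a * b * 2 by nra.
by apply: (le_trans ab); rewrite ler_wpM2l// mulr_ge0; lra.
Qed.

Lemma exp_growthX q n : exp_growth q -> exp_growth (fun y => q y ^+ n).
Proof.
move=> eq; elim: n => [|n IH]; first exact: exp_growth_cst.
by under eq_fun do rewrite exprS; exact: exp_growthM.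
Qed.

Lemma exp_growthN q : exp_growth q -> exp_growth (fun y => - q y).
Proof.
move=> eq; under eq_fun do rewrite -mulN1r.
by apply: exp_growthM => //; exact: exp_growth_cst.
Qed.

Lemma exp_growthB q f : exp_growth q -> exp_growth f ->
  exp_growth (fun y => q y - f y).
Proof. by move=> eq ef; apply: exp_growthD => //; exact: exp_growthN. Qed.

Lemma exp_growth_norm q : exp_growth q -> exp_growth (fun y => `|q y|).
Proof.
move=> [cq [K K0 qK]]; split; last by exists K => // y; rewrite normr_id.
by move=> x; apply: cvg_norm; exact: cq.
Qed.

Lemma exp_growth_expR f K : continuous f ->
  (forall y, `|f y| <= K * (1 + `|y|)) -> exp_growth (fun y => expR (f y)).
Proof.
move=> cf fK; have K0 : 0 <= K.
  by have := fK 0; rewrite normr0 addr0 mulr1; apply: le_trans.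
split.
  by move=> x; apply: (@continuous_comp _ _ _ f expR);
    [exact: cf|exact: continuous_expR].
exists K => // y; rewrite ger0_norm ?expR_ge0// ler_expR.
by apply: le_trans (fK y); exact: ler_norm.
Qed.

Lemma exp_growth_measurable q : exp_growth q -> measurable_fun setT q.
Proof. by move=> [cq _]; exact: continuous_measurable_fun. Qed.

End ExpGrowth.

#[global] Hint Resolve exp_growth_cst exp_growth_id exp_growthM exp_growthD
  exp_growthX exp_growthN exp_growthB exp_growth_norm : expgrowth.

Section GaussianIntegral.
Context {R : realType}.
Implicit Types q f g : R -> R.
Local Notation mu := (@lebesgue_measure R).

Definition gauss_kernel (s x y : R) := expR (- s * (x - y) ^+ 2).

Lemma continuous_gauss_kernel s x : continuous (gauss_kernel s x).
Proof.
move=> y; apply: (@continuous_comp _ _ _ (fun y => - s * (x - y) ^+ 2) expR).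
  apply: cvgM; first exact: cvg_cst.
  apply: (@continuous_comp _ _ _ (fun y => x - y) (fun z => z ^+ 2)).
    by apply: cvgB; [exact: cvg_cst|exact: cvg_id].
  exact: exprn_continuous.
exact: continuous_expR.
Qed.

(** The dominating Gaussian does not depend on x in a bounded set nor on rates above s. It therefore
    serves for integrability, for differentiation under the integral in x and in s, and for the
    decay of boundary terms. *)
Lemma gauss_kernel_domination q s A : exp_growth q -> 0 < s ->
  exists2 C, 0 <= C & forall s' x y, s <= s' -> `|x| <= A ->
    `|q y * gauss_kernel s' x y| <= C * expR (- (s / 4) * y ^+ 2).
Proof.
(* In s (x - y)^2 >= s (y^2/2 - A^2), one half of s y^2/2 absorbs K |y| <= s y^2/4 + K^2/s, and the
   other half stays in the exponent. *)
move=> [_ [K K0 qK]] s0; exists (expR (s * A ^+ 2 + K + K ^+ 2 / s)).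
  exact: expR_ge0.
move=> s' x y ss' xA; rewrite normrM [X in _ * X]ger0_norm ?expR_ge0//.
apply: (le_trans (ler_wpM2r (expR_ge0 _) (qK y))).
rewrite -!expRD ler_expR.
have A2 : x ^+ 2 <= A ^+ 2.
  by rewrite -real_normK ?num_real// lerXn2r// nnegrE// (le_trans _ xA).
have y2 : `|y| ^+ 2 = y ^+ 2 by rewrite real_normK ?num_real.
have amgm : K * `|y| <= s * y ^+ 2 / 4 + K ^+ 2 / s.
  have : 0 <= (s * `|y| / 2 - K) ^+ 2 / s by rewrite divr_ge0 ?sqr_ge0 ?ltW.
  suff -> : (s * `|y| / 2 - K) ^+ 2 / s = s * `|y| ^+ 2 / 4 - K * `|y| + K ^+ 2 / s.
    by rewrite y2; lra.
  by field; rewrite gt_eqF.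
have h1 : s * (x - y) ^+ 2 <= s' * (x - y) ^+ 2 by rewrite ler_wpM2r ?sqr_ge0.
have h2 : s * (y ^+ 2 / 2 - A ^+ 2) <= s * (x - y) ^+ 2.
  rewrite ler_wpM2l ?(ltW s0)//.
  have : 0 <= (x *+ 2 - y) ^+ 2 by rewrite sqr_ge0.
  rewrite -mulr_natl; nra.
lra.
Qed.

Lemma integrable_gauss_kernel0 (s : R) : 0 < s ->
  mu.-integrable setT (EFin \o (fun y : R => expR (- s * y ^+ 2))).
Proof.
(* The centred normal density of variance 1/(2s) is a constant multiple of this Gaussian. *)
move=> s0; pose d := (Num.sqrt (2 * s))^-1.
have d0 : 0 < d by rewrite invr_gt0 sqrtr_gt0 mulr_gt0.
have := @integrable_normal_pdf R 0 d.
rewrite /normal_pdf (gt_eqF d0) => intp.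
have := integrableZl measurableT (normal_peak d)^-1 intp.
apply: eq_integrable => // y _; rewrite /= -EFinM mulrA mulVf ?mul1r; last first.
  by rewrite gt_eqF// normal_peak_gt0// gt_eqF.
rewrite /normal_fun subr0 /d exprVn sqr_sqrtr ?mulr_ge0 ?ltW//.
by congr (expR _)%:E; field; rewrite gt_eqF.
Qed.

Lemma integrable_gauss_kernel q s x : exp_growth q -> 0 < s ->
  mu.-integrable setT (EFin \o (fun y => q y * gauss_kernel s x y)).
Proof.
move=> eq s0; have [C C0 qC] := gauss_kernel_domination `|x| eq s0.
have s40 : 0 < s / 4 by lra.
have intg := integrableZl measurableT C (integrable_gauss_kernel0 s40).
apply: (le_integrable measurableT _ _ intg).
  apply/measurable_EFinP; apply: measurable_funM.
    exact: exp_growth_measurable.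
  by apply: continuous_measurable_fun; exact: continuous_gauss_kernel.
move=> y _; rewrite /= lee_fin (le_trans (qC s x y _ _))//.
exact: ler_norm.
Qed.

Definition gauss_int q s x : R := \int[mu]_y (q y * gauss_kernel s x y).

Lemma gauss_intD q f s x : exp_growth q -> exp_growth f -> 0 < s ->
  gauss_int (fun y => q y + f y) s x = gauss_int q s x + gauss_int f s x.
Proof.
move=> eq ef s0; rewrite /gauss_int; under eq_Rintegral do rewrite mulrDl.
by rewrite RintegralD//; exact: integrable_gauss_kernel.
Qed.

Lemma gauss_intZ c q s x : exp_growth q -> 0 < s ->
  gauss_int (fun y => c * q y) s x = c * gauss_int q s x.
Proof.
move=> eq s0; rewrite /gauss_int; under eq_Rintegral do rewrite -mulrA.
by rewrite RintegralZl//; exact: integrable_gauss_kernel.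
Qed.

Lemma gauss_intB q f s x : exp_growth q -> exp_growth f -> 0 < s ->
  gauss_int (fun y => q y - f y) s x = gauss_int q s x - gauss_int f s x.
Proof.
move=> eq ef s0; rewrite gauss_intD//; last exact: exp_growthN.
by under [in X in _ + X]eq_fun do rewrite -mulN1r; rewrite gauss_intZ// mulN1r.
Qed.

Lemma le_gauss_int q f s x : exp_growth q -> exp_growth f -> 0 < s ->
  (forall y, q y <= f y) -> gauss_int q s x <= gauss_int f s x.
Proof.
move=> eq ef s0 qf; apply: le_Rintegral => //; [exact: integrable_gauss_kernel..|].
by move=> y _; rewrite ler_wpM2r ?expR_ge0.
Qed.

(** A zero integral would force the positive integrand to vanish almost everywhere, and then [0, 1]
    would lie in a null set. This makes the denominators of the means invertible. *)
Lemma gauss_int_gt0 q s x : exp_growth q -> 0 < s -> (forall y, 0 < q y) ->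
  0 < gauss_int q s x.
Proof.
move=> eq s0 q0; have pos y : 0 < q y * gauss_kernel s x y.
  by rewrite mulr_gt0 ?expR_gt0.
have intq := integrable_gauss_kernel x eq s0.
have W0 : 0 <= gauss_int q s x by apply: Rintegral_ge0 => y _; rewrite ltW.
rewrite lt_neqAle W0 andbT eq_sym; apply/negP => /eqP W00.
have : (\int[mu]_y `|(q y * gauss_kernel s x y)%:E| = 0)%E.
  under eq_integral do rewrite gee0_abs ?lee_fin ?ltW//.
  by rewrite -(fineK (integrable_fin_num measurableT intq)); congr _%:E.
move/(ae_eq_integral_abs mu measurableT); case/integrableP: (intq) => mq _.
move=> /(_ mq) [N [mN N0 subN]].
have : (mu `[0%R, 1%R]%classic <= mu N)%E.
  apply: le_measure; rewrite ?inE// => y _; apply: subN => /= /(_ I) [] /eqP.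
  by rewrite gt_eqF.
by rewrite N0 lebesgue_measure_itv/= lte_fin ltr01 oppr0 adde0 leNgt lte01.
Qed.
End GaussianIntegral.

(** * Differentiation and integration by parts *)

Section DerivRules.
Context {R : realType}.
Implicit Types (f g : R -> R) (x a b : R).

Lemma is_derive1D f g x a b : is_derive x 1 f a -> is_derive x 1 g b ->
  is_derive x 1 (fun y => f y + g y) (a + b).
Proof. by move=> ? ?; exact: is_deriveD. Qed.

Lemma is_derive1N f x a : is_derive x 1 f a ->
  is_derive x 1 (fun y => - f y) (- a).
Proof. by move=> ?; exact: is_deriveN. Qed.

Lemma is_derive1B f g x a b : is_derive x 1 f a -> is_derive x 1 g b ->
  is_derive x 1 (fun y => f y - g y) (a - b).
Proof. by move=> ? ?; exact: is_deriveB. Qed.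

Lemma is_derive1M f g x a b : is_derive x 1 f a -> is_derive x 1 g b ->
  is_derive x 1 (fun y => f y * g y) (a * g x + f x * b).
Proof.
move=> fa gb; apply: is_derive_eq (is_deriveM fa gb) _.
by rewrite addrC /GRing.scale/= mulrC.
Qed.

Lemma is_derive1_chain f g x a b : is_derive (g x) 1 f a -> is_derive x 1 g b ->
  is_derive x 1 (fun y => f (g y)) (a * b).
Proof.
by move=> fa gb; exact: is_derive1_comp.
Qed.

Lemma is_derive1V f x a : f x != 0 -> is_derive x 1 f a ->
  is_derive x 1 (fun y => (f y)^-1) (- a / f x ^+ 2).
Proof.
move=> fx0 fa; apply: is_derive_eq (is_deriveV fx0 fa) _.
by rewrite /GRing.scale/= !mulNr mulrC.
Qed.

Lemma is_derive1_cst c x : is_derive x 1 (fun=> c) (0 : R).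
Proof. exact: is_derive_cst. Qed.

Lemma is_derive1_id x : is_derive x 1 (fun y : R => y) (1 : R).
Proof. exact: is_derive_id. Qed.

Lemma is_derive1X f n x a : is_derive x 1 f a ->
  is_derive x 1 (fun y => f y ^+ n) (n%:R * f x ^+ n.-1 * a).
Proof.
move=> fa; elim: n => [|n IH].
  by apply: is_derive_eq (is_derive1_cst 1 x) _; rewrite !mul0r.
under eq_fun do rewrite exprS.
apply: is_derive_eq (is_derive1M fa IH) _ => /=.
case: n {IH} => [|n] /=; first by rewrite !expr0; ring.
by rewrite exprS -(natr1 n.+1); ring.
Qed.

Lemma is_derive1_expR f x a : is_derive x 1 f a ->
  is_derive x 1 (fun y => expR (f y)) (a * expR (f x)).
Proof.
move=> fa; rewrite mulrC.
exact: (is_derive1_chain (is_derive_expR (f x)) fa).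
Qed.

Lemma is_derive1_continuous f x a : is_derive x 1 f a -> {for x, continuous f}.
Proof.
by move=> fa; apply/differentiable_continuous/derivable1_diffP/(@ex_derive _ _ _ _ _ _ _ fa).
Qed.

Lemma derive1_is_derive f x a : is_derive x 1 f a -> derive1 f x = a.
Proof. by move=> fa; rewrite derive1E derive_val. Qed.

Lemma derivable_is_derive1 f x : derivable f x 1 -> is_derive x 1 f (derive1 f x).
Proof. by move=> df; rewrite derive1E; exact: derivableP. Qed.
End DerivRules.

Section GaussDerive.
Context {R : realType}.
Implicit Types q f g : R -> R.
Local Notation mu := (@lebesgue_measure R).

Lemma is_derive_gauss_kernel_pos (s x y : R) :
  is_derive x 1 (fun x => gauss_kernel s x y)
    (- 2 * s * (x - y) * gauss_kernel s x y).
Proof.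
rewrite /gauss_kernel; apply: is_derive_eq.
by rewrite /GRing.scale/=; ring.
Qed.

Lemma is_derive_gauss_kernel_var (s x y : R) :
  is_derive y 1 (gauss_kernel s x) (2 * s * (x - y) * gauss_kernel s x y).
Proof.
rewrite /gauss_kernel; apply: is_derive_eq.
by rewrite /GRing.scale/=; ring.
Qed.

Lemma is_derive_gauss_kernel_scale (s x y : R) :
  is_derive s 1 (fun s => gauss_kernel s x y)
    (- (x - y) ^+ 2 * gauss_kernel s x y).
Proof.
rewrite /gauss_kernel; apply: is_derive_eq.
by rewrite /GRing.scale/=; ring.
Qed.

Lemma is_derive_Rintegral (f df : R -> R -> R) (G : R -> R) (a r : R) :
  0 < r ->
  (forall x, `|x - a| < r -> mu.-integrable setT (EFin \o f x)) ->
  (forall x y, `|x - a| < r -> is_derive x 1 (f ^~ y) (df x y)) ->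
  (forall y, 0 <= G y) -> mu.-integrable setT (EFin \o G) ->
  (forall x y, `|x - a| < r -> `|df x y| <= G y) ->
  is_derive a 1 (fun x => \int[mu]_y f x y) (\int[mu]_y df a y).
Proof.
move=> r0 fint fder G0 Gint Gub.
have itvE x : `]a - r, a + r[%classic x -> `|x - a| < r.
  by rewrite /= in_itv/= ltr_distl.
have Ia : `]a - r, a + r[%classic a.
  by rewrite /= in_itv/=; apply/andP; split; lra.
have partE x y : `|x - a| < r -> partial1of2 f x y = df x y.
  by move=> xr; rewrite /partial1of2 (derive1_is_derive (fder x y xr)).
have H1 x : `]a - r, a + r[%classic x -> mu.-integrable setT (EFin \o f x).
  by move=> /itvE/fint.
have H2 x y : `]a - r, a + r[%classic x -> setT y -> derivable (f ^~ y) x 1.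
  by move=> /itvE xr _; exact: (@ex_derive _ _ _ _ _ _ _ (fder x y xr)).
have H3 x y : `]a - r, a + r[%classic x -> setT y -> `|partial1of2 f x y| <= G y.
  by move=> /itvE xr _; rewrite partE// Gub.
have d1 := derivable_under_integral measurableT Ia H1 H2 G0 Gint H3.
have e1 := differentiation_under_integral measurableT Ia H1 H2 G0 Gint H3.
apply: is_derive_eq (derivable_is_derive1 d1) _.
rewrite e1; apply: eq_Rintegral => y _; rewrite partE//.
by rewrite subrr normr0.
Qed.

Lemma is_derive_gauss_int_pos q (s x : R) : exp_growth q -> 0 < s ->
  is_derive x 1 (gauss_int q s)
    (2 * s * (gauss_int (fun y => y * q y) s x - x * gauss_int q s x)).
Proof.
move=> eq s0.
(* For |z - x| < 1, the factor 2 s |z - y| brought down by the derivative is at most 2 s (|x| + 1 +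
   |y|). *)
pose Q y := 2 * s * ((`|x| + 1 + `|y|) * `|q y|).
have eQ : exp_growth Q by rewrite /Q; auto 10 with expgrowth.
have [C C0 QC] := gauss_kernel_domination (`|x| + 1) eQ s0.
have s40 : 0 < s / 4 by lra.
have bnd z : `|z - x| < 1 -> `|z| <= `|x| + 1.
  by move=> zx; have := lerB_dist z x; lra.
have [|||||] := @is_derive_Rintegral (fun x y => q y * gauss_kernel s x y)
   (fun x y => q y * (- 2 * s * (x - y) * gauss_kernel s x y))
   (fun y => C * expR (- (s / 4) * y ^+ 2)) x 1 ltr01.
- by move=> z _; exact: integrable_gauss_kernel.
- move=> z y _.
  have := is_derive1M (is_derive1_cst (q y) z) (is_derive_gauss_kernel_pos s z y).
  by rewrite mul0r add0r.
- by move=> y; rewrite mulr_ge0// expR_ge0.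
- by have := integrableZl measurableT C (integrable_gauss_kernel0 s40).
- move=> z y /bnd zx; apply: le_trans (QC s z y (lexx _) zx).
  have -> : q y * (- 2 * s * (z - y) * gauss_kernel s z y) =
    - (2 * s) * ((z - y) * q y) * gauss_kernel s z y by ring.
  have s20 : 0 <= 2 * s by lra.
  rewrite normrM [leRHS]normrM ler_wpM2r// normrM normrN [`|2 * s|]ger0_norm// normrM.
  rewrite [leRHS]ger0_norm; last by rewrite /Q mulr_ge0// mulr_ge0// !addr_ge0.
  rewrite /Q ler_wpM2l// ler_wpM2r//.
  by have := ler_normB z y; lra.
move=> H1 H2; apply: is_derive_eq (DeriveDef H1 H2) _.
have exq : exp_growth (fun y => x * q y) by auto with expgrowth.
have eyq : exp_growth (fun y => y * q y).
  by apply: exp_growthM => //; exact: exp_growth_id.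
rewrite -gauss_intZ// -gauss_intB// -gauss_intZ//; last exact: exp_growthB.
by apply: eq_Rintegral => y _; ring.
Qed.

Lemma is_derive_gauss_int_scale q (s x : R) : exp_growth q -> 0 < s ->
  is_derive s 1 (fun s => gauss_int q s x)
    (- gauss_int (fun y => (x - y) ^+ 2 * q y) s x).
Proof.
move=> eq s0.
pose Q y := (x - y) ^+ 2 * q y.
have eQ : exp_growth Q.
  by apply: exp_growthM => //; apply: exp_growthX; auto with expgrowth.
(* The domination is uniform only over rates bounded below, so the rate is confined to a
   neighbourhood of s of radius s/2. *)
have s20 : 0 < s / 2 by lra.
have [C C0 QC] := gauss_kernel_domination `|x| eQ s20.
have s40 : 0 < s / 2 / 4 by lra.
have bnd z : `|z - s| < s / 2 -> s / 2 <= z.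
  by rewrite ltr_norml => /andP[]; lra.
have [|||||] := @is_derive_Rintegral (fun s y => q y * gauss_kernel s x y)
   (fun s y => q y * (- (x - y) ^+ 2 * gauss_kernel s x y))
   (fun y => C * expR (- (s / 2 / 4) * y ^+ 2)) s (s / 2) s20.
- by move=> z /bnd zs; apply: integrable_gauss_kernel => //; lra.
- move=> z y _.
  have := is_derive1M (is_derive1_cst (q y) z) (is_derive_gauss_kernel_scale z x y).
  by rewrite mul0r add0r.
- by move=> y; rewrite mulr_ge0// expR_ge0.
- by have := integrableZl measurableT C (integrable_gauss_kernel0 s40).
- move=> z y /bnd zs; apply: le_trans (QC z x y zs (lexx _)).
  by rewrite mulNr mulrN normrN mulrA [q y * _]mulrC.
move=> H1 H2; apply: is_derive_eq (DeriveDef H1 H2) _.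
rewrite -mulN1r -gauss_intZ//.
by apply: eq_Rintegral => y _; ring.
Qed.

(** The fundamental theorem of calculus on growing symmetric intervals, followed by dominated
    convergence with |f| itself as the bound. *)
Lemma Rintegral_derive_eq0 (F f : R -> R) :
  (forall x : R, is_derive x 1 F (f x)) ->
  continuous f -> mu.-integrable setT (EFin \o f) ->
  F n%:R @[n --> \oo] --> 0 -> F (- n%:R) @[n --> \oo] --> 0 ->
  \int[mu]_x f x = 0.
Proof.
move=> dF cf intf Foo FNoo.
have cF : continuous F by move=> x; exact: is_derive1_continuous (dF x).
(* The successor keeps every interval nondegenerate, as the fundamental theorem requires. *)
pose I (n : nat) := `[(- n.+1%:R : R), n.+1%:R]%classic.
have FTC n : (\int[mu]_(x in I n) (f x)%:E = (F n.+1%:R - F (- n.+1%:R))%:E)%E.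
  have n0 : - n.+1%:R < n.+1%:R :> R.
    by rewrite (@lt_trans _ _ 0)// ?oppr_lt0 ltr0n.
  rewrite EFinB; apply: continuous_FTC2 => //.
  - exact: continuous_subspaceT.
  - split; [by move=> x _; exact: (@ex_derive _ _ _ _ _ _ _ (dF x))| |].
    + by apply: cvg_at_right_filter; exact: cF.
    + by apply: cvg_at_left_filter; exact: cF.
  - by move=> x _; exact: derive1_is_derive (dF x).
have mf : measurable_fun setT (EFin \o f) by case/integrableP: intf.
have mI n : measurable (I n) by exact: measurable_itv.
have [|||||_ _ DCT] := @dominated_convergence _ _ _ mu _ measurableT
    (fun n => (EFin \o f) \_ (I n)) (EFin \o f) (abse \o (EFin \o f)).
- by move=> n; apply/(measurable_restrictT _ (mI n)); exact: measurable_funS mf.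
- exact: mf.
- apply: aeW => /= x _; apply: cvg_near_cst; near=> n.
  rewrite patchE mem_set// /I /= in_itv/= -ler_norml.
  apply: (@le_trans _ _ n%:R); last by rewrite ler_nat.
  by near: n; exact: nbhs_infty_ger.
- exact: integrable_abse.
- by apply: aeW => x n _ /=; rewrite patchE; case: ifP => // _; rewrite abse0.
have lim0 : F n.+1%:R - F (- n.+1%:R) @[n --> \oo] --> 0 - 0.
  by apply: cvgB; [rewrite (cvg_shiftS (fun n => F n%:R))
                  |rewrite (cvg_shiftS (fun n => F (- n%:R)))].
have lim1 : (F n.+1%:R - F (- n.+1%:R))%:E @[n --> \oo] --> (0 : \bar R).
  by apply/fine_cvgP; split; [exact: nearW|rewrite subr0 in lim0].
have E : (\int[mu]_x (f x)%:E = 0)%E.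
  apply: (cvg_unique _ _ lim1) => //; apply: cvg_trans DCT.
  by under eq_fun do rewrite -FTC integral_mkcond.
by rewrite /Rintegral E.
Unshelve. all: by end_near. Qed.

(** The derivative of Q times the kernel integrates to 0, because the kernel decays faster than Q
    grows; the kernel itself contributes the factor 2 s (x - y). *)
Lemma gauss_int_by_parts (Q dQ : R -> R) (s x : R) : (forall y : R, is_derive y 1 Q (dQ y)) ->
  exp_growth Q -> exp_growth dQ -> 0 < s ->
  gauss_int dQ s x = 2 * s * gauss_int (fun y => (y - x) * Q y) s x.
Proof.
move=> dQ' eQ edQ s0.
have eyQ : exp_growth (fun y => (y - x) * Q y).
  by apply: exp_growthM => //; auto with expgrowth.
rewrite -gauss_intZ//; apply/eqP; rewrite -subr_eq0 -gauss_intB//; last first.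
  by auto with expgrowth.
apply/eqP; set f := fun y => _ - _.
have ef : exp_growth f by rewrite /f; auto with expgrowth.
have [C C0 QC] := gauss_kernel_domination `|x| eQ s0.
have s40 : 0 < s / 4 by lra.
(* Both ends n and -n are treated at once, since the dominating Gaussian sees only u_n^2 = n^2, and
   exp(-(s/4) n^2) is at most the geometric sequence exp(-s/4)^n. *)
have lim (u : R^nat) : (forall n, u n ^+ 2 = n%:R ^+ 2) ->
    Q (u n) * gauss_kernel s x (u n) @[n --> \oo] --> 0.
  move=> u2; apply/norm_cvg0P.
  pose b := expR (- (s / 4)).
  apply: (@squeeze_cvgr _ _ _ _ (cst 0) (fun n => C * b ^+ n)).
  - apply: nearW => n; rewrite normr_ge0/=.
    apply: (le_trans (QC s x (u n) (lexx _) (lexx _))).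
    rewrite ler_wpM2l// u2 -expRM_natl ler_expR mulrC.
    rewrite ler_wnM2r ?oppr_le0 ?(ltW s40)//.
    by rewrite -natrX ler_nat; case: n => // n; rewrite leq_pmulr.
  - exact: cvg_cst.
  rewrite -[X in _ --> X](mulr0 C); apply: cvgM; first exact: cvg_cst.
  by apply: cvg_expr; rewrite ger0_norm ?expR_ge0// expR_lt1 oppr_lt0.
apply: (@Rintegral_derive_eq0 (fun y => Q y * gauss_kernel s x y)).
- move=> y; apply: is_derive_eq (is_derive1M (dQ' y) (is_derive_gauss_kernel_var s x y)) _.
  by rewrite /f; ring.
- move=> y; apply: cvgM; first by case: ef => + _; apply.
  exact: continuous_gauss_kernel.
- exact: integrable_gauss_kernel.
- by apply: lim.
- by apply: lim => n; rewrite sqrrN.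
Qed.

End GaussDerive.

(** * Weighted Gaussian means and their moments *)

Section Primitive.
Context {R : realType}.
Local Notation mu := (@lebesgue_measure R).

Lemma is_derive_primitive0 (h : R -> R) (y : R) : continuous h ->
  is_derive y 1 (primitive0 h) (h y).
Proof.
move=> ch; pose n := `|y| + 1.
have int a b : mu.-integrable `[a, b] (EFin \o h).
  apply: continuous_compact_integrable; first exact: segment_compact.
  exact: continuous_subspaceT.
(* Integrating from -n instead of 0 gives a single formula F z - F 0 on both sides of 0, so the sign
   convention of [primitive0] needs no case distinction in the derivative. *)
pose F z : R := \int[mu]_(t in `[- n, z]) h t.
have /andP[yn1 yn2] : - n < y < n by rewrite -ltr_norml ltrDl.
have n0 : 0 < n by rewrite ltr_wpDl.
have primE z : - n < z < n -> primitive0 h z = F z - F 0.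
  move=> /andP[z1 z2]; rewrite /primitive0; case: ifPn => z0.
    rewrite /F Rintegral_itvB ?bnd_simp//; last by rewrite oppr_le0 ltW.
    rewrite Rintegral_itv_obnd_cbnd//.
    by apply: integrableS (int 0 z) => //; exact: subset_itv_oc_cc.
  rewrite -ltNge in z0.
  rewrite -[RHS]opprB /F Rintegral_itvB ?bnd_simp//; [|exact: ltW..].
  rewrite Rintegral_itv_obnd_cbnd//.
  by apply: integrableS (int z 0) => //; exact: subset_itv_oc_cc.
have [dF F'y] := @continuous_FTC1_closed _ h (- n) y n yn2 (int _ _) yn1 (ch y).
have := is_derive1B (derivable_is_derive1 dF) (is_derive1_cst (F 0) y).
rewrite F'y subr0; apply: near_eq_is_derive.
have : \forall z \near y, z \in `](- n), n[.
  by apply: near_in_itvoo; rewrite in_itv/= yn1 yn2.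
by apply: filterS => z; rewrite in_itv/= => /primE ->.
Qed.

Lemma primitive00 (h : R -> R) : primitive0 h 0 = 0.
Proof. by rewrite /primitive0 lexx set_itv1 Rintegral_set1. Qed.

Lemma continuous_primitive0 (h : R -> R) : continuous h ->
  continuous (primitive0 h).
Proof.
by move=> ch y; exact: is_derive1_continuous (is_derive_primitive0 y ch).
Qed.

Lemma primitive0_bound (h : R -> R) M : continuous h ->
  (forall y, `|h y| <= M) -> forall y, `|primitive0 h y| <= M * `|y|.
Proof.
move=> ch hM y.
have cw (a b : R) : {within `[a, b], continuous (primitive0 h)}.
  by apply: continuous_subspaceT; exact: continuous_primitive0.
have [y0|y0] := leP 0 y.
  have [c _] := MVT_segment y0 (fun x _ => is_derive_primitive0 x ch) (cw _ _).
  by rewrite primitive00 !subr0 => ->; rewrite normrM ler_wpM2r.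
have [c _] := MVT_segment (ltW y0) (fun x _ => is_derive_primitive0 x ch) (cw _ _).
rewrite primitive00 !sub0r => /eqP; rewrite eqr_oppLR => /eqP ->.
by rewrite normrN normrM normrN ler_wpM2r.
Qed.
End Primitive.

Section GaussMean.
Context {R : realType} (g : R -> R).
Hypothesis g_growth : exp_growth g.
Hypothesis g_gt0 : forall y, 0 < g y.
Implicit Types q f : R -> R.

(** With [g] the part of the weight free of (x, t), this is the mean E; a constant factor in the
    kernel would cancel in the quotient. *)
Definition gauss_mean q (s x : R) : R :=
  gauss_int (fun y => q y * g y) s x / gauss_int g s x.

Let mass_gt0 s x : 0 < s -> 0 < gauss_int g s x.
Proof. by move=> s0; exact: gauss_int_gt0. Qed.

Let growthMg q : exp_growth q -> exp_growth (fun y => q y * g y).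
Proof. by move=> eq; exact: exp_growthM. Qed.

Lemma gauss_meanD q f s x : exp_growth q -> exp_growth f -> 0 < s ->
  gauss_mean (fun y => q y + f y) s x = gauss_mean q s x + gauss_mean f s x.
Proof.
move=> eq ef s0; rewrite /gauss_mean -mulrDl -gauss_intD//; [|exact: growthMg..].
by congr (gauss_int _ _ _ / _); apply/funext => y; rewrite mulrDl.
Qed.

Lemma gauss_meanZ c q s x : exp_growth q -> 0 < s ->
  gauss_mean (fun y => c * q y) s x = c * gauss_mean q s x.
Proof.
move=> eq s0; rewrite /gauss_mean mulrA -gauss_intZ//; last exact: growthMg.
by congr (gauss_int _ _ _ / _); apply/funext => y; rewrite mulrA.
Qed.

Lemma gauss_meanB q f s x : exp_growth q -> exp_growth f -> 0 < s ->
  gauss_mean (fun y => q y - f y) s x = gauss_mean q s x - gauss_mean f s x.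
Proof.
move=> eq ef s0; rewrite /gauss_mean -mulrBl -gauss_intB//; [|exact: growthMg..].
by congr (gauss_int _ _ _ / _); apply/funext => y; rewrite mulrBl.
Qed.

Lemma gauss_mean_cst c s x : 0 < s -> gauss_mean (fun=> c) s x = c.
Proof.
by move=> s0; rewrite /gauss_mean gauss_intZ// mulfK// gt_eqF// mass_gt0.
Qed.

Lemma le_gauss_mean q f s x : exp_growth q -> exp_growth f -> 0 < s ->
  (forall y, q y <= f y) -> gauss_mean q s x <= gauss_mean f s x.
Proof.
move=> eq ef s0 qf; rewrite /gauss_mean ler_wpM2r//.
  by rewrite invr_ge0 ltW// mass_gt0.
by apply: le_gauss_int => //; [exact: growthMg..|move=> y; rewrite ler_wpM2r// ltW].
Qed.

Lemma ler_norm_gauss_mean q f s x : exp_growth q -> exp_growth f -> 0 < s ->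
  (forall y, `|q y| <= f y) -> `|gauss_mean q s x| <= gauss_mean f s x.
Proof.
move=> eq ef s0 qf; rewrite ler_norml -mulN1r -gauss_meanZ//.
apply/andP; split; apply: le_gauss_mean => //; first by auto with expgrowth.
  by move=> y; have := qf y; rewrite ler_norml mulN1r => /andP[].
by move=> y; have := qf y; rewrite ler_norml => /andP[].
Qed.

(** The logarithmic derivative of the kernel in x is -2 s (x - y). Its part constant in y cancels by
    normalisation, which leaves 2 s times the covariance of q and y. *)
Lemma is_derive_gauss_mean_pos q (s x : R) : exp_growth q -> 0 < s ->
  is_derive x 1 (gauss_mean q s)
    (2 * s * (gauss_mean (fun y => y * q y) s x
              - gauss_mean q s x * gauss_mean id s x)).
Proof.
move=> eq s0; have m0 : gauss_int g s x != 0 by rewrite gt_eqF// mass_gt0.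
have dq := is_derive_gauss_int_pos x (growthMg eq) s0.
have dg := is_derive1V m0 (is_derive_gauss_int_pos x g_growth s0).
apply: is_derive_eq (is_derive1M dq dg) _; rewrite /gauss_mean.
under [in RHS]eq_fun do rewrite -mulrA.
by field.
Qed.

(** Likewise the covariance of q with -(x - y)^2: the term x^2 cancels, which leaves the covariances
    with y and with y^2. *)
Lemma is_derive_gauss_mean_scale q (s x : R) : exp_growth q -> 0 < s ->
  is_derive s 1 (fun s => gauss_mean q s x)
    (2 * x * (gauss_mean (fun y => y * q y) s x
              - gauss_mean q s x * gauss_mean id s x)
     - (gauss_mean (fun y => y ^+ 2 * q y) s x
              - gauss_mean q s x * gauss_mean (fun y => y ^+ 2) s x)).
Proof.
move=> eq s0; have m0 : gauss_int g s x != 0 by rewrite gt_eqF// mass_gt0.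
have dq := is_derive_gauss_int_scale x (growthMg eq) s0.
have dg := @is_derive1V _ (fun s => gauss_int g s x) _ _ m0
  (is_derive_gauss_int_scale x g_growth s0).
have expand f : exp_growth f -> gauss_int (fun y => (x - y) ^+ 2 * f y) s x =
    x ^+ 2 * gauss_int f s x - 2 * x * gauss_int (fun y => y * f y) s x
    + gauss_int (fun y => y ^+ 2 * f y) s x.
  move=> ef; have eyf : exp_growth (fun y => y * f y).
    by apply: exp_growthM => //; exact: exp_growth_id.
  have eyyf : exp_growth (fun y => y ^+ 2 * f y).
    by apply: exp_growthM => //; apply: exp_growthX; exact: exp_growth_id.
  rewrite -!gauss_intZ// -gauss_intB// -?gauss_intD//; try by auto with expgrowth.
  by congr (gauss_int _ _ _); apply/funext => y; ring.
apply: is_derive_eq (is_derive1M dq dg) _; rewrite /gauss_mean !expand//; last first.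
  exact: growthMg.
have -> : (fun y => y * q y * g y) = (fun y => y * (q y * g y)).
  by apply/funext => y; rewrite mulrA.
have -> : (fun y => y ^+ 2 * q y * g y) = (fun y => y ^+ 2 * (q y * g y)).
  by apply/funext => y; rewrite mulrA.
by field.
Qed.

Variable h : R -> R.
Hypothesis h_growth : exp_growth h.
Hypothesis dg : forall y : R, is_derive y 1 g (- h y * g y).

(** Here [h] is the drift -g'/g, so differentiating Q g produces dQ - Q h under the mean. *)
Lemma gauss_mean_by_parts (Q dQ : R -> R) (s x : R) :
  (forall y : R, is_derive y 1 Q (dQ y)) ->
  exp_growth Q -> exp_growth dQ -> 0 < s ->
  2 * s * gauss_mean (fun y => (y - x) * Q y) s x =
  gauss_mean dQ s x - gauss_mean (fun y => Q y * h y) s x.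
Proof.
move=> derQ eQ edQ s0; have eQh : exp_growth (fun y => Q y * h y) by exact: exp_growthM.
rewrite -gauss_meanB// /gauss_mean mulrA; congr (_ / _).
have eF : exp_growth (fun y => (dQ y - Q y * h y) * g y).
  by apply: growthMg; exact: exp_growthB.
rewrite (@gauss_int_by_parts _ (fun y => Q y * g y) _ s x _ _ eF s0).
- by congr (_ * gauss_int _ _ _); apply/funext => y; rewrite mulrA.
- move=> y; apply: is_derive_eq (is_derive1M (derQ y) (dg y)) _; ring.
- exact: growthMg.
Qed.

Variable H : R.
Hypothesis h_bound : forall y, `|h y| <= H.

(** Integration by parts with Q = z^(2k+1), z = y - x, gives 2 s times the moment of order 2k+2. The
    drift term is split by |z| |h| <= s z^2 + H^2/(4 s); its first part is only half of the left
    side and is absorbed there. *)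
Lemma gauss_moment_rec k s x : 0 < s ->
  gauss_mean (fun y => (y - x) ^+ k.*2.+2) s x <=
  (k.*2.+1%:R / s + (H / (2 * s)) ^+ 2) * gauss_mean (fun y => (y - x) ^+ k.*2) s x.
Proof.
move=> s0; have H0 : 0 <= H by apply: le_trans (h_bound 0).
have ez j : exp_growth (fun y => (y - x) ^+ j).
  by apply: exp_growthX; auto with expgrowth.
have dz (y : R) : is_derive y 1 (fun y => (y - x) ^+ k.*2.+1)
    (k.*2.+1%:R * (y - x) ^+ k.*2).
  apply: is_derive_eq (is_derive1X _ (is_derive1B (is_derive1_id y)
    (is_derive1_cst x y))) _.
  by rewrite subr0 mulr1.
have := gauss_mean_by_parts x dz (ez _) (exp_growthM (exp_growth_cst _) (ez _)) s0.
under [X in gauss_mean X]eq_fun do rewrite -exprS.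
set X1 := gauss_mean _ s x; set X0 := gauss_mean (fun y => (y - x) ^+ k.*2) s x.
rewrite gauss_meanZ// -/X0 => IBP.
have : `|gauss_mean (fun y => (y - x) ^+ k.*2.+1 * h y) s x| <=
    s * X1 + H ^+ 2 / (4 * s) * X0.
  rewrite /X1 /X0 -!gauss_meanZ// -gauss_meanD//; [|by auto with expgrowth..].
  apply: ler_norm_gauss_mean => //; [by auto with expgrowth..|].
  move=> y; set z := y - x; rewrite !exprS !normrM.
  have zk : 0 <= z ^+ k.*2 by rewrite exprn_even_ge0// odd_double.
  rewrite [`|z ^+ _|]ger0_norm//.
  have amgm : `|z| * `|h y| <= s * (z * z) + H ^+ 2 / (4 * s).
    apply: (@le_trans _ _ (`|z| * H)); first exact: ler_wpM2l.
    rewrite -expr2 -[z ^+ 2](real_normK (num_real z)) -subr_ge0.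
    have -> : s * `|z| ^+ 2 + H ^+ 2 / (4 * s) - `|z| * H =
        (2 * s * `|z| - H) ^+ 2 / (4 * s) by field; rewrite gt_eqF.
    by rewrite divr_ge0 ?sqr_ge0//; lra.
  have := ler_wpM2r zk amgm; lra.
rewrite -normrN => /(le_trans (ler_norm _)) bnd.
have IBP' : s * X1 <= (k.*2.+1%:R + H ^+ 2 / (4 * s)) * X0.
  by rewrite mulrDl; lra.
have -> : (k.*2.+1%:R / s + (H / (2 * s)) ^+ 2) * X0 =
    (k.*2.+1%:R + H ^+ 2 / (4 * s)) * X0 / s by field; rewrite gt_eqF.
by rewrite ler_pdivlMr// mulrC.
Qed.

Lemma gauss_moment_bound k s x : 0 < s ->
  gauss_mean (fun y => (y - x) ^+ k.*2) s x <=
  (k.*2%:R / s + (H / (2 * s)) ^+ 2) ^+ k.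
Proof.
move=> s0; set B := _ + _.
have B0 : 0 <= B by rewrite /B addr_ge0 ?sqr_ge0// divr_ge0// ltW.
(* The constant [B] is fixed by k before the induction on j: it bounds each recursion factor, since
   2j+1 <= 2k for j < k. *)
suff : forall j, (j <= k)%N -> gauss_mean (fun y => (y - x) ^+ j.*2) s x <= B ^+ j.
  exact.
elim=> [_|j IH jk]; first by rewrite gauss_mean_cst.
rewrite doubleS; apply: (le_trans (gauss_moment_rec _ _ s0)).
rewrite [leRHS]exprS ler_pM//; last exact/IH/ltnW.
- by rewrite addr_ge0 ?sqr_ge0// divr_ge0// ltW.
- rewrite -(gauss_mean_cst 0 x s0); apply: le_gauss_mean => //.
  + by auto with expgrowth.
  + by auto with expgrowth.
  by move=> y; rewrite exprn_even_ge0// odd_double.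
- by rewrite lerD2r ler_wpM2r ?invr_ge0 ?(ltW s0)// ler_nat ltn_double.
Qed.

Lemma gauss_mean_growth_bound q k M s x : exp_growth q -> 0 < s ->
  (forall y, `|q y| <= M * (1 + y ^+ k.*2)) ->
  `|gauss_mean q s x| <=
  M * (1 + 4 ^+ k * (x ^+ k.*2 + (k.*2%:R / s + (H / (2 * s)) ^+ 2) ^+ k)).
Proof.
move=> eq s0 qM; have M0 : 0 <= M.
  have := qM 0; rewrite expr0n -(pmulr_lge0 M (_ : 0 < 1 + (k.*2 == 0%N)%:R :> R)).
    by rewrite mulrC; apply: le_trans.
  by rewrite ltr_wpDr.
have ez : exp_growth (fun y => (y - x) ^+ k.*2).
  by apply: exp_growthX; auto with expgrowth.
have eb : exp_growth (fun y => M * (1 + 4 ^+ k * (x ^+ k.*2 + (y - x) ^+ k.*2))).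
  by auto 10 with expgrowth.
apply: (@le_trans _ _ (gauss_mean
    (fun y => M * (1 + 4 ^+ k * (x ^+ k.*2 + (y - x) ^+ k.*2))) s x)).
  apply: ler_norm_gauss_mean => // y; apply: (le_trans (qM y)).
  rewrite ler_wpM2l// lerD2l -!mul2n !exprM.
  (* As y = x + (y - x), y^2 is at most four times the larger of x^2 and (y - x)^2. *)
  have [xz|xz] := leP ((y - x) ^+ 2) (x ^+ 2).
    apply: (@le_trans _ _ (4 ^+ k * (x ^+ 2) ^+ k)).
      have y2 : y ^+ 2 <= 4 * x ^+ 2 by have := sqr_ge0 (2 * x - y); nra.
      by rewrite -exprMn lerXn2r// nnegrE ?sqr_ge0// (le_trans (sqr_ge0 y)).
    by rewrite ler_wpM2l ?exprn_ge0// lerDl exprn_ge0// sqr_ge0.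
  apply: (@le_trans _ _ (4 ^+ k * ((y - x) ^+ 2) ^+ k)).
    have y2 : y ^+ 2 <= 4 * (y - x) ^+ 2 by have := sqr_ge0 (2 * x - y); nra.
    by rewrite -exprMn lerXn2r// nnegrE ?sqr_ge0// (le_trans (sqr_ge0 y)).
  by rewrite ler_wpM2l ?exprn_ge0// lerDr exprn_ge0// sqr_ge0.
rewrite gauss_meanZ ?gauss_meanD ?gauss_mean_cst ?gauss_meanZ ?gauss_meanD
  ?gauss_mean_cst//; try by auto 10 with expgrowth.
rewrite ler_wpM2l// lerD2l ler_wpM2l ?exprn_ge0// lerD2l.
exact: gauss_moment_bound.
Qed.

End GaussMean.

(** * Polynomial expressions in the moments *)

Section Tau.
Context {R : realType} (alpha : R).
Hypothesis alpha_neq0 : alpha != 0.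

Lemma is_derive_tau (t : R) : is_derive t 1 (tau alpha) (expR (- alpha * t)).
Proof.
rewrite /tau; have d1 := is_derive1M (is_derive1_cst (- alpha) t) (is_derive1_id t).
have d2 := is_derive1B (is_derive1_cst 1 t) (is_derive1_expR d1).
apply: is_derive_eq (is_derive1M d2 (is_derive1_cst alpha^-1 t)) _.
by field.
Qed.

Lemma tau0 : tau alpha 0 = 0.
Proof. by rewrite /tau mulr0 expR0 subrr mul0r. Qed.

Lemma continuous_tau : continuous (tau alpha).
Proof. by move=> t; exact: is_derive1_continuous (is_derive_tau t). Qed.

(** The derivative exp(-alpha t) is positive for either sign of alpha, so the mean value theorem
    settles both cases. *)
Lemma tau_lt (s t : R) : s < t -> tau alpha s < tau alpha t.
Proof.
move=> st; have [|c _] := MVT st (fun x _ => is_derive_tau x).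
  by apply: continuous_subspaceT; exact: continuous_tau.
by rewrite -subr_gt0 => ->; rewrite mulr_gt0 ?expR_gt0 ?subr_gt0.
Qed.

Lemma tau_le (s t : R) : s <= t -> tau alpha s <= tau alpha t.
Proof. by rewrite le_eqVlt => /predU1P[->//|/tau_lt/ltW]. Qed.

Lemma tau_gt0 (t : R) : 0 < t -> 0 < tau alpha t.
Proof. by rewrite -{2}tau0; exact: tau_lt. Qed.
End Tau.

Section MomentExpressions.
Context {R : realType}.
Implicit Types (a b : R -> R) (e t : R) (p : R * R).

(** The Hopf-Cole transform of the initial datum [a]: the factor of the weight that does not involve
    (x, t). *)
Definition hopf e a y : R := expR (- primitive0 a y / (2 * e)).

(** The rate of the heat kernel of diffusivity e at time tau. *)
Definition diffusivity_rate (alpha e t : R) : R := (4 * e * tau alpha t)^-1.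

(** A boolean suffices as exponent of the primitive of b: V is linear in it, and differentiating a
    mean multiplies the integrand by powers of y only. *)
Definition moment_weight b (i : bool) y : R := if i then primitive0 b y else 1.

Definition moment alpha e a b i k p : R :=
  gauss_mean (hopf e a) (fun y => y ^+ k * moment_weight b i y)
    (diffusivity_rate alpha e p.2) p.1.

(* Polynomial expressions in the quantities below, a class stable under [dx]
   and [dt] that contains all the families of the theorem. *)
Inductive mexp :=
| MCst of R
| MInvTau
| MExp
| MInvEps
| MX
| MMom of bool & nat
| MAdd of mexp & mexp
| MMul of mexp & mexp.

Fixpoint meval alpha e a b (E : mexp) p : R :=
  match E with
  | MCst c => c
  | MInvTau => (tau alpha p.2)^-1
  | MExp => expR (- alpha * p.2)
  | MInvEps => e^-1
  | MX => p.1
  | MMom i k => moment alpha e a b i k p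
  | MAdd E F => meval alpha e a b E p + meval alpha e a b F p
  | MMul E F => meval alpha e a b E p * meval alpha e a b F p
  end.

(** The covariance of y^k p^i and y^j, where p is the primitive of b. *)
Definition mcov (i : bool) (k j : nat) : mexp :=
  MAdd (MMom i (j + k)) (MMul (MCst (- 1)) (MMul (MMom i k) (MMom false j))).

Fixpoint mdx (E : mexp) : mexp :=
  match E with
  | MX => MCst 1
  | MMom i k => MMul (MCst 2^-1) (MMul (MMul MInvTau MInvEps) (mcov i k 1))
  | MAdd E F => MAdd (mdx E) (mdx F)
  | MMul E F => MAdd (MMul (mdx E) F) (MMul E (mdx F))
  | _ => MCst 0
  end.

(** For [MMom] this is the chain rule through the rate: the prefactor is the time derivative of
    [diffusivity_rate], and the bracket is the derivative of the mean with respect to the rate. *)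
Fixpoint mdt (alpha : R) (E : mexp) : mexp :=
  match E with
  | MInvTau => MMul (MCst (- 1)) (MMul MExp (MMul MInvTau MInvTau))
  | MExp => MMul (MCst (- alpha)) MExp
  | MMom i k =>
    MMul (MMul (MMul (MCst (- 4^-1)) MInvEps) (MMul MExp (MMul MInvTau MInvTau)))
      (MAdd (MMul (MMul (MCst 2) MX) (mcov i k 1)) (MMul (MCst (- 1)) (mcov i k 2)))
  | MAdd E F => MAdd (mdt alpha E) (mdt alpha F)
  | MMul E F => MAdd (MMul (mdt alpha E) F) (MMul E (mdt alpha F))
  | _ => MCst 0
  end.

Definition cont_bounded (M : R) a := continuous a /\ forall y, `|a y| <= M.

Lemma exp_growth_primitive0 M b : cont_bounded M b -> exp_growth (primitive0 b).
Proof.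
move=> [cb bM]; apply: (@exp_growth_of_lin _ _ M); first exact: continuous_primitive0.
move=> y; apply: (le_trans (primitive0_bound cb bM y)).
by rewrite ler_wpM2l ?lerDr// (le_trans _ (bM 0)).
Qed.

Lemma exp_growth_bounded M a : cont_bounded M a -> exp_growth a.
Proof.
move=> [cb bM]; apply: (@exp_growth_of_lin _ _ M) => // y.
by apply: (le_trans (bM y)); rewrite ler_peMr ?lerDl// (le_trans _ (bM 0)).
Qed.

(** An even power of y is what the moment bound accepts; k+1 leaves room for the additional degree
    of the primitive. *)
Lemma moment_weight_bound M b i k y : cont_bounded M b ->
  `|y ^+ k * moment_weight b i y| <= (1 + M) * (1 + y ^+ k.+1.*2).
Proof.
move=> bM; have M0 : 0 <= M by apply: le_trans (bM.2 0).
have -> : y ^+ k.+1.*2 = `|y| ^+ k.+1 ^+ 2.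
  by rewrite -exprM mulnC -mul2n exprM -[in LHS](real_normK (num_real y)) -exprM.
have yk : `|y| ^+ k <= 1 + `|y| ^+ k.+1 ^+ 2.
  have [y1|y1] := leP `|y| 1.
    by rewrite (le_trans (exprn_ile1 _ _ _))// lerDl sqr_ge0.
  rewrite -exprM (@le_trans _ _ (`|y| ^+ (k.+1 * 2)))// ?lerDr//.
  by rewrite ler_weXn2l ?(ltW y1)// (leq_trans (leqnSn k))// leq_pmulr.
have yk1 : `|y| ^+ k.+1 <= 1 + `|y| ^+ k.+1 ^+ 2.
  by have := sqr_ge0 (`|y| ^+ k.+1 - 1); have := exprn_ge0 k.+1 (normr_ge0 y); nra.
rewrite normrM normrX /moment_weight; case: i.
  apply: (@le_trans _ _ (M * `|y| ^+ k.+1)).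
    rewrite mulrC exprS mulrA ler_wpM2r ?exprn_ge0//.
    exact: primitive0_bound bM.1 bM.2 y.
  by have := sqr_ge0 (`|y| ^+ k.+1); nra.
by rewrite normr1 mulr1; have := sqr_ge0 (`|y| ^+ k.+1); nra.
Qed.

Lemma is_derive_hopf e a (y : R) : continuous a ->
  is_derive y 1 (hopf e a) (- (a y / (2 * e)) * hopf e a y).
Proof.
move=> ca; have := is_derive1_expR (is_derive1M
  (is_derive1N (is_derive_primitive0 y ca)) (is_derive1_cst (2 * e)^-1 y)).
by rewrite mulr0 addr0 mulNr.
Qed.

Lemma hopf_gt0 e a y : 0 < hopf e a y.
Proof. exact: expR_gt0. Qed.

Lemma exp_growth_hopf M e a : 0 < e -> cont_bounded M a -> exp_growth (hopf e a).
Proof.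
move=> e0 [ca aM]; have M0 : 0 <= M by apply: le_trans (aM 0).
apply: (@exp_growth_expR _ _ (M / (2 * e))).
  move=> y; apply: cvgM; last exact: cvg_cst.
  by apply: cvgN; exact: continuous_primitive0.
move=> y; have e20 : 0 < (2 * e)^-1 by rewrite invr_gt0; lra.
rewrite normrM normrN [`|_^-1|]gtr0_norm// mulrAC ler_wpM2r ?(ltW e20)//.
by apply: (le_trans (primitive0_bound ca aM y)); rewrite ler_wpM2l// lerDr.
Qed.

Lemma exp_growth_moment M b i k : cont_bounded M b ->
  exp_growth (fun y => y ^+ k * moment_weight b i y).
Proof.
move=> bM; have eb := exp_growth_primitive0 bM.
by rewrite /moment_weight; case: i; auto with expgrowth.
Qed.

Section Derivatives.
Variables (alpha e M : R) (a b : R -> R).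
Hypotheses (alpha_neq0 : alpha != 0) (e_gt0 : 0 < e).
Hypotheses (aM : cont_bounded M a) (bM : cont_bounded M b).
Local Notation ev := (meval alpha e a b).

Lemma diffusivity_rate_gt0 t : 0 < t -> 0 < diffusivity_rate alpha e t.
Proof.
move=> t0; rewrite invr_gt0; apply: mulr_gt0 (tau_gt0 alpha_neq0 t0).
by rewrite mulr_gt0.
Qed.

Local Notation mean := (gauss_mean (hopf e a)).

Lemma meval_mcov i k j x t (s := diffusivity_rate alpha e t)
    (q := fun y => y ^+ k * moment_weight b i y) :
  ev (mcov i k j) (x, t) =
  mean (fun y => y ^+ j * q y) s x - mean q s x * mean (fun y => y ^+ j) s x.
Proof.
rewrite /= mulN1r /moment/=; congr (_ - _ * _).
  by congr (gauss_mean _ _ _ _); apply/funext => y; rewrite exprD mulrA.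
by congr (gauss_mean _ _ _ _); apply/funext => y; rewrite mulr1.
Qed.

Lemma meval_mcov1 i k x t (s := diffusivity_rate alpha e t)
    (q := fun y => y ^+ k * moment_weight b i y) :
  ev (mcov i k 1) (x, t) =
  mean (fun y => y * q y) s x - mean q s x * mean id s x.
Proof. exact: meval_mcov. Qed.

Lemma is_derive_meval_pos E p : 0 < p.2 ->
  is_derive p.1 1 (fun x => ev E (x, p.2)) (ev (mdx E) p).
Proof.
case: p => x t /= t0; elim: E => [c||||| i k|E IHE F IHF|E IHE F IHF] /=;
  try exact: is_derive1_cst.
- exact: is_derive1_id.
- have s0 := diffusivity_rate_gt0 t0.
  have dm := is_derive_gauss_mean_pos (exp_growth_hopf e_gt0 aM) (hopf_gt0 e a) x
    (exp_growth_moment i k bM) s0.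
  apply: is_derive_eq dm _.
  have tau0 := tau_gt0 alpha_neq0 t0.
  rewrite -meval_mcov1/= /diffusivity_rate.
  by field; rewrite !gt_eqF.
- exact: is_derive1D.
- exact: is_derive1M.
Qed.

Lemma is_derive_meval_time E p : 0 < p.2 ->
  is_derive p.2 1 (fun t => ev E (p.1, t)) (ev (mdt alpha E) p).
Proof.
case: p => x t /= t0; have tau0 := tau_gt0 alpha_neq0 t0.
have s0 := diffusivity_rate_gt0 t0.
have nz : 4 * e * tau alpha t != 0 by rewrite gt_eqF// mulr_gt0// mulr_gt0.
elim: E => [c||||| i k|E IHE F IHF|E IHE F IHF] /=; try exact: is_derive1_cst.
- apply: is_derive_eq (is_derive1V _ (is_derive_tau alpha_neq0 t)) _.
    by rewrite gt_eqF.
  by field; rewrite gt_eqF.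
- apply: is_derive_eq (is_derive1_expR (is_derive1M (is_derive1_cst (- alpha) t)
    (is_derive1_id t))) _.
  by rewrite mul0r add0r mulr1.
- have drate := @is_derive1V _ (fun t => 4 * e * tau alpha t) t _ nz (is_derive1M (is_derive1_cst (4 * e) t)
    (is_derive_tau alpha_neq0 t)).
  have dm := @is_derive1_chain _ (fun s => mean (fun y => y ^+ k * moment_weight b i y) s x)
    (diffusivity_rate alpha e) t _ _ (is_derive_gauss_mean_scale (exp_growth_hopf e_gt0 aM)
     (hopf_gt0 e a) x (exp_growth_moment i k bM) s0) drate.
  apply: is_derive_eq dm _.
  rewrite -meval_mcov1 -meval_mcov/=.
  by field; rewrite !gt_eqF.
- exact: is_derive1D.
- exact: is_derive1M.
Qed.
End Derivatives.

(** A bound on the power of 1/e. Moments count for 0, as they are locally bounded uniformly in e. *)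
Fixpoint mdegree (E : mexp) : nat :=
  match E with
  | MInvEps => 1
  | MAdd E F => maxn (mdegree E) (mdegree F)
  | MMul E F => mdegree E + mdegree F
  | _ => 0
  end.

(** The constant is chosen before e, a and b: it depends on the data only through M, which is what
    the limit e -> 0 demands. *)
Lemma meval_bound alpha M A t1 t2 E : alpha != 0 -> 0 < t1 ->
  exists2 C, 0 <= C & forall e a b p, 0 < e < 1 -> cont_bounded M a ->
    cont_bounded M b -> `|p.1| <= A -> t1 <= p.2 <= t2 ->
    `|meval alpha e a b E p| <= C * e^-1 ^+ mdegree E.
Proof.
move=> al0 t10.
elim: E => [c||||| i k|E [C C0 IHE] F [D D0 IHF]|E [C C0 IHE] F [D D0 IHF]] /=.
- by exists `|c| => // *; rewrite mulr1.
- exists (tau alpha t1)^-1; first by rewrite invr_ge0 ltW// tau_gt0.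
  move=> e a b p _ _ _ _ /andP[pt1 pt2]; rewrite mulr1.
  have tt := tau_gt0 al0 t10.
  have pp : 0 < tau alpha p.2 by apply: tau_gt0 => //; exact: lt_le_trans pt1.
  by rewrite gtr0_norm ?invr_gt0// lef_pV2 ?posrE// tau_le.
- exists (expR (`|alpha| * t2)); first exact: expR_ge0.
  move=> e a b p _ _ _ _ /andP[pt1 pt2]; rewrite mulr1 ger0_norm ?expR_ge0// ler_expR.
  have p20 : 0 <= p.2 by apply: (le_trans (ltW t10)).
  apply: (@le_trans _ _ (`|alpha| * p.2)); last exact: ler_wpM2l.
  by rewrite ler_wpM2r// -normrN ler_norm.
- exists 1 => // e a b p /andP[e0 _] _ _ _ _.
  by rewrite mul1r expr1 ger0_norm// invr_ge0 ltW.
- exists (Num.max A 0); first by rewrite le_max lexx orbT.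
  by move=> e a b p _ _ _ pA _; rewrite mulr1 le_max pA.
- have [M0|M0] := ltP M 0.
    exists 0 => // e a b p _ [_ aM].
    by have := le_lt_trans (normr_ge0 _) (le_lt_trans (aM 0) M0); rewrite ltxx.
  (* No order between t1 and t2 is assumed, so [T] may be negative; |T| keeps the constant
     nonnegative. *)
  pose K := k.+1; pose T := tau alpha t2.
  exists ((1 + M) * (1 + 4 ^+ K * (A ^+ K.*2 +
     (K.*2%:R * (4 * `|T|) + (M * `|T|) ^+ 2) ^+ K))).
    rewrite mulr_ge0 ?addr_ge0// mulr_ge0 ?exprn_ge0// addr_ge0//.
      by rewrite exprn_even_ge0// odd_double.
    by rewrite exprn_ge0// addr_ge0 ?sqr_ge0// !mulr_ge0.
  move=> e a b p /andP[e0 e1] aM bM pA /andP[pt1 pt2].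
  have p20 : 0 < p.2 by apply: (lt_le_trans t10).
  have tp := tau_gt0 al0 p20; have s0 := diffusivity_rate_gt0 al0 e0 p20.
  have tT : tau alpha p.2 <= `|T| by apply: (le_trans (tau_le al0 pt2)); exact: ler_norm.
  have e20 : 0 < (2 * e)^-1 by rewrite invr_gt0; lra.
  have hb y : `|a y / (2 * e)| <= M / (2 * e).
    by rewrite normrM [`|_^-1|]gtr0_norm// ler_wpM2r ?(ltW e20)// aM.2.
  have eh : exp_growth (fun y => a y / (2 * e)).
    by apply: exp_growthM (exp_growth_bounded aM) (exp_growth_cst _).
  rewrite mulr1; apply: (le_trans (gauss_mean_growth_bound (exp_growth_hopf e0 aM)
    (hopf_gt0 e a) eh (fun y => is_derive_hopf e y aM.1) hb p.1
    (exp_growth_moment i k bM) s0 (fun y => moment_weight_bound i k y bM))).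
  rewrite ler_wpM2l ?addr_ge0// lerD2l ler_wpM2l ?exprn_ge0// lerD//.
    rewrite -mul2n !exprM lerXn2r ?nnegrE ?sqr_ge0//.
    by rewrite -[leLHS](real_normK (num_real p.1)) lerXn2r// nnegrE// (le_trans _ pA).
  (* The powers of e cancel here: a drift of size M/(2e) against the rate 1/(4 e tau). *)
  have -> : (M / (2 * e)) / (2 * diffusivity_rate alpha e p.2) = M * tau alpha p.2.
    by rewrite /diffusivity_rate; field; rewrite !gt_eqF.
  rewrite lerXn2r ?nnegrE ?addr_ge0 ?sqr_ge0 ?divr_ge0 ?mulr_ge0 ?(ltW s0)//.
  rewrite lerD//.
    rewrite ler_wpM2l// /diffusivity_rate invrK -mulrA ler_wpM2l//.
    by apply: le_trans tT; rewrite ler_piMl// ltW.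
  have MtMT : M * tau alpha p.2 <= M * `|T| by exact: ler_wpM2l.
  have Mt : 0 <= M * tau alpha p.2 by rewrite mulr_ge0// ltW.
  by apply: lerXn2r => //; rewrite nnegrE// (le_trans Mt).
- exists (C + D) => [|e a b p e01 aM bM pA pt]; first exact: addr_ge0.
  apply: (le_trans (ler_normD _ _)).
  apply: (le_trans (lerD (IHE _ _ _ _ e01 aM bM pA pt) (IHF _ _ _ _ e01 aM bM pA pt))).
  have e1 : 1 <= e^-1 by case/andP: e01 => e0 e1; rewrite invf_ge1// ltW.
  rewrite mulrDl lerD// ler_wpM2l//; apply: ler_weXn2l => //.
    exact: leq_maxl.
  exact: leq_maxr.
- exists (C * D) => [|e a b p e01 aM bM pA pt]; first exact: mulr_ge0.
  rewrite normrM exprD mulrACA.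
  exact: ler_pM (IHE _ _ _ _ e01 aM bM pA pt) (IHF _ _ _ _ e01 aM bM pA pt).
Qed.
End MomentExpressions.

(** * Smoothness and moderateness *)

Section Plane.
Context {R : realType}.
Implicit Types (f : R * R -> R) (K U : set (R * R)).

Lemma open_Omega : open (@Omega R).
Proof.
rewrite /Omega; have -> : [set p : R * R | 0 < p.2] = snd @^-1` [set t : R | 0 < t].
  by [].
by apply: open_comp; [move=> p _; exact: cvg_snd|exact: open_gt].
Qed.

Lemma near_line_pos U (p : R * R) : open U -> U p -> \forall x \near p.1, U (x, p.2).
Proof.
move=> oU Up; have : (x, p.2) @[x --> p.1] --> p.
  by case: p {Up} => x t /=; apply: (@cvg_pair _ _ _ _ (nbhs x) (nbhs t));
    [exact: cvg_id|exact: cvg_cst].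
by move=> /(_ U) /=; apply; rewrite nbhsE; exists U.
Qed.

Lemma near_line_time U (p : R * R) : open U -> U p -> \forall t \near p.2, U (p.1, t).
Proof.
move=> oU Up; have : (p.1, t) @[t --> p.2] --> p.
  by case: p {Up} => x t /=; apply: (@cvg_pair _ _ _ _ (nbhs x) (nbhs t));
    [exact: cvg_cst|exact: cvg_id].
by move=> /(_ U) /=; apply; rewrite nbhsE; exists U.
Qed.

Lemma eq_dx_on U f g : open U -> {in U, f =1 g} -> {in U, dx f =1 dx g}.
Proof.
move=> oU fg p /set_mem Up; rewrite /dx !derive1E; apply: near_eq_derive.
by apply: filterS (near_line_pos oU Up) => x Ux; rewrite fg// mem_set.
Qed.

Lemma eq_dt_on U f g : open U -> {in U, f =1 g} -> {in U, dt f =1 dt g}.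
Proof.
move=> oU fg p /set_mem Up; rewrite /dt !derive1E; apply: near_eq_derive.
by apply: filterS (near_line_time oU Up) => x Ux; rewrite fg// mem_set.
Qed.

Lemma Ck_ext U k f g : open U -> {in U, f =1 g} -> Ck U k f -> Ck U k g.
Proof.
move=> oU; elim: k f g => [|k IH] f g fg /= [cf df].
  split=> // p Up; rewrite /prop_for /continuous_at -fg ?mem_set//.
  apply: cvg_trans (cf p Up); apply: near_eq_cvg.
  have := open_nbhs_nbhs (conj oU Up).
  by apply: filterS => q Uq; rewrite fg// mem_set.
case: df => pf dxf dtf; split; last split.
- move=> p Up; rewrite /prop_for /continuous_at -fg ?mem_set//.
  apply: cvg_trans (cf p Up); apply: near_eq_cvg.
  have := open_nbhs_nbhs (conj oU Up).
  by apply: filterS => q Uq; rewrite fg// mem_set.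
- move=> p Up; have [px pt] := pf p Up; split.
    apply: near_eq_derivable px.
    by apply: filterS (near_line_pos oU Up) => x Ux; rewrite fg// mem_set.
  apply: near_eq_derivable pt.
  by apply: filterS (near_line_time oU Up) => x Ux; rewrite fg// mem_set.
- by apply: IH dxf; exact: eq_dx_on.
- by apply: IH dtf; exact: eq_dt_on.
Qed.

(** Partial derivatives alone do not give joint continuity. A local bound on the x-derivative makes
    f Lipschitz in x uniformly in t, and continuity in t along one vertical line then suffices. *)
Lemma continuous_of_bounded_dx f (fx : R * R -> R) (x0 t0 C r : R) : 0 < r ->
  (forall x t, `|x - x0| < r -> `|t - t0| < r ->
     is_derive x 1 (fun x => f (x, t)) (fx (x, t))) ->
  (forall x t, `|x - x0| < r -> `|t - t0| < r -> `|fx (x, t)| <= C) ->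
  {for t0, continuous (fun t => f (x0, t))} -> {for (x0, t0), continuous f}.
Proof.
move=> r0 dfx fxC ct; have C0 : 0 <= C.
  by apply: le_trans (fxC x0 t0 _ _); rewrite ?subrr ?normr0.
have lip x t : `|x - x0| < r -> `|t - t0| < r ->
    `|f (x, t) - f (x0, t)| <= C * `|x - x0|.
  move=> xr tr.
  have near y : (x <= y <= x0) || (x0 <= y <= x) -> `|y - x0| < r.
    move=> h; apply: le_lt_trans xr; case/orP: h => /andP[h1 h2].
      by rewrite !ler0_norm; lra.
    by rewrite !ger0_norm; lra.
  have cont a b : (forall y, a <= y <= b -> `|y - x0| < r) ->
      {within `[a, b], continuous (fun x => f (x, t))}.
    move=> h; apply: derivable_within_continuous => y; rewrite in_itv/= => /h yr.
    exact: (@ex_derive _ _ _ _ _ _ _ (dfx y t yr tr)).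
  have [xx0|/ltW xx0] := leP x0 x.
    have [||c] := @MVT_segment _ (fun x => f (x, t)) (fun x => fx (x, t)) x0 x xx0.
    - move=> y; rewrite in_itv/= => /andP[h1 h2]; apply: dfx => //.
      by apply: near; rewrite (ltW h1) (ltW h2) orbT.
    - by apply: cont => y h; apply: near; rewrite h orbT.
    - rewrite in_itv/= => hc ->; rewrite normrM ler_wpM2r// fxC//.
      by apply: near; rewrite hc orbT.
  have [||c] := @MVT_segment _ (fun x => f (x, t)) (fun x => fx (x, t)) x x0 xx0.
  - move=> y; rewrite in_itv/= => /andP[h1 h2]; apply: dfx => //.
    by apply: near; rewrite (ltW h1) (ltW h2).
  - by apply: cont => y h; apply: near; rewrite h.
  - rewrite in_itv/= distrC => hc ->; rewrite normrM [`|x0 - x|]distrC ler_wpM2r// fxC//.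
    by apply: near; rewrite hc.
apply/cvgrPdist_lt => eps eps0.
have e20 : 0 < eps / 2 by lra.
have d0 : 0 < Num.min r (eps / 2 / (C + 1)).
  by rewrite lt_min r0/= divr_gt0//; lra.
have hx : \forall p \near (x0, t0), `|x0 - p.1| < Num.min r (eps / 2 / (C + 1)).
  have c1 : p.1 @[p --> (x0, t0)] --> x0 by exact: cvg_fst.
  by move/cvgrPdist_lt: c1; apply.
have ht : \forall p \near (x0, t0), `|t0 - p.2| < r.
  have c2 : p.2 @[p --> (x0, t0)] --> t0 by exact: cvg_snd.
  by move/cvgrPdist_lt: c2; apply.
have hf : \forall p \near (x0, t0), `|f (x0, t0) - f (x0, p.2)| < eps / 2.
  have : f (x0, p.2) @[p --> (x0, t0)] --> f (x0, t0).
    by apply: (@cvg_comp _ _ _ snd (fun t => f (x0, t)) _ (nbhs t0)) => //; exact: cvg_snd.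
  by move/cvgrPdist_lt; apply.
near=> p.
have px : `|p.1 - x0| < Num.min r (eps / 2 / (C + 1)) by rewrite distrC; near: p.
have pt : `|p.2 - t0| < r by rewrite distrC; near: p.
have pf : `|f (x0, t0) - f (x0, p.2)| < eps / 2 by near: p.
move: px; rewrite lt_min => /andP[pxr pxe].
have := lip p.1 p.2 pxr pt; rewrite -surjective_pairing distrC => lp.
have : C * `|p.1 - x0| <= eps / 2.
  move: pxe; rewrite ltr_pdivlMr; last lra.
  by have := normr_ge0 (p.1 - x0); nra.
move=> Cp; rewrite (splitr eps).
rewrite (_ : f (x0, t0) - f p = (f (x0, t0) - f (x0, p.2)) + (f (x0, p.2) - f p)); last first.
  by ring.
by apply: (le_lt_trans (ler_normD _ _)); rewrite ltr_leD// (le_trans lp).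
Unshelve. all: by end_near. Qed.

Lemma compact_in_Omega K : compact K -> K `<=` Omega ->
  exists A t1 t2 : R, 0 < t1 /\
    forall p, K p -> `|p.1| <= A /\ t1 <= p.2 <= t2.
Proof.
move=> cK KO.
have bounded_image (f : R * R -> R) : {within K, continuous f} ->
    exists B, forall p, K p -> `|f p| <= B.
  move=> cf; have /compact_bounded [B [_ HB]] := continuous_compact cf cK.
  exists (B + 1) => p Kp; apply: (HB (B + 1)); first by rewrite ltrDl.
  by exists p.
have [A HA] := bounded_image fst (continuous_subspaceT (fun p => cvg_fst)).
have [B HB] := bounded_image snd (continuous_subspaceT (fun p => cvg_snd)).
(* Bounding 1/t on K keeps K away from the line t = 0. *)
have [D HD] : exists B, forall p, K p -> `|p.2^-1| <= B.
  apply: bounded_image; apply: continuous_in_subspaceT => p /set_mem Kp.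
  apply: cvgV; last exact: cvg_snd.
  by rewrite gt_eqF//; exact: KO.
exists A, (`|D| + 1)^-1, B; split=> [|p Kp].
  by rewrite invr_gt0 ltr_wpDl.
split; first exact: HA.
have p2 : 0 < p.2 := KO p Kp.
apply/andP; split; last by apply: le_trans (HB p Kp); exact: ler_norm.
rewrite -[leRHS]invrK lef_pV2 ?posrE ?invr_gt0 ?ltr_wpDl//.
apply: (@le_trans _ _ D); last by have := ler_norm D; lra.
by apply: le_trans (HD p Kp); exact: ler_norm.
Qed.

Lemma Linfty_norm_le K f (C : R) : 0 <= C -> (forall p, K p -> `|f p| <= C) ->
  (Linfty_norm K f <= C%:E)%E.
Proof.
move=> C0 fC; rewrite /Linfty_norm unlock /=; case: ifPn => // _.
apply/ess_supP; apply: nearW => p /=; rewrite lee_fin patchE.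
by case: ifPn => [/set_mem/fC//|_]; rewrite normr0.
Qed.

(** If |g| exceeded C at x, by continuity it would do so on a whole interval [x, x + d/2], which is
    not null. *)
Lemma Linfty_norm1_bound (g : R -> R) (C : R) : continuous g ->
  (Linfty_norm1 setT g <= C%:E)%E -> forall x, `|g x| <= C.
Proof.
move=> cg; rewrite /Linfty_norm1 unlock /=.
have mono a b : a <= b -> (lebesgue_measure `[a, b]%classic = (b - a)%:E :> \bar R)%E.
  move=> ab; rewrite lebesgue_measure_itv/= lte_fin; case: ltP => // ba.
  by rewrite (_ : a = b) ?subrr//; apply/eqP; rewrite eq_le ab.
(* The norm of exponent infinity is defined by cases on whether the total measure is positive. *)
have -> : (0 < @lebesgue_measure R setT)%E.
  apply: (@lt_le_trans _ _ (@lebesgue_measure R `[0, 1]%classic)).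
    by rewrite mono// subr0 lte_fin.
  by apply: le_measure; rewrite ?inE.
move=> /ess_supP [N [mN N0 subN]] x; rewrite leNgt; apply/negP => gx.
have : \forall y \near x, C < `|g y|.
  have cng : {for x, continuous (fun y => `|g y|)} by apply: cvg_norm; exact: cg.
  by apply: (cvgr_gt _ cng).
move=> [/= d d0 hd].
have : (@lebesgue_measure R `[x, (x + d / 2)%R]%classic <= lebesgue_measure N)%E.
  apply: le_measure; rewrite ?inE// => y; rewrite /= in_itv/= => /andP[y1 y2].
  apply: subN => /=; rewrite patchE mem_set// lee_fin; apply/negP; rewrite -ltNge.
  by apply: hd; rewrite /= distrC ger0_norm; lra.
by rewrite N0 mono ?lee_fin; lra.
Qed.
End Plane.

Section Regularity.
Context {R : realType} (alpha : R).
Hypothesis alpha_neq0 : alpha != 0.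

Section FixedEpsilon.
Variables (e M : R) (a b : R -> R).
Hypotheses (e01 : 0 < e < 1) (aM : cont_bounded M a) (bM : cont_bounded M b).
Local Notation ev := (meval alpha e a b).

Lemma continuous_meval E (p : R * R) : Omega p -> {for p, continuous (ev E)}.
Proof.
case: p => x0 t0; rewrite /Omega /= => t00; have [e0 _] := andP e01.
have t20 : 0 < t0 / 2 by lra.
have [C C0 HC] := meval_bound M (`|x0| + t0) (t0 + t0) (mdx E) alpha_neq0 t20.
have time t : `|t - t0| < t0 / 2 -> t0 / 2 <= t <= t0 + t0.
  by rewrite ltr_norml => /andP[h1 h2]; apply/andP; split; lra.
apply: (@continuous_of_bounded_dx _ _ (ev (mdx E)) x0 t0
  (C * e^-1 ^+ mdegree (mdx E)) (t0 / 2)) => //.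
- move=> x t _ /time /andP[tt _].
  apply: (is_derive_meval_pos alpha_neq0 e0 aM bM E (p := (x, t))).
  exact: lt_le_trans tt.
- move=> x t xx /time tt; apply: HC => //=.
  by have := lerB_dist x x0; lra.
- exact: is_derive1_continuous
    (is_derive_meval_time alpha_neq0 e0 aM bM E (p := (x0, t0)) t00).
Qed.

Lemma dx_meval E f : {in Omega, f =1 ev E} -> {in Omega, dx f =1 ev (mdx E)}.
Proof.
move=> fE p pO; rewrite (eq_dx_on open_Omega fE pO) /dx.
have [e0 _] := andP e01; move/set_mem: pO => pO.
exact: derive1_is_derive (is_derive_meval_pos alpha_neq0 e0 aM bM E pO).
Qed.

Lemma dt_meval E f : {in Omega, f =1 ev E} ->
  {in Omega, dt f =1 ev (mdt alpha E)}.
Proof.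
move=> fE p pO; rewrite (eq_dt_on open_Omega fE pO) /dt.
have [e0 _] := andP e01; move/set_mem: pO => pO.
exact: derive1_is_derive (is_derive_meval_time alpha_neq0 e0 aM bM E pO).
Qed.

Lemma iter_meval j l E f : {in Omega, f =1 ev E} ->
  {in Omega, iter j dt (iter l dx f) =1 ev (iter j (mdt alpha) (iter l mdx E))}.
Proof.
move=> fE; elim: j => [|j IH]; last exact: dt_meval.
by elim: l => [//|l IH]; exact: dx_meval.
Qed.

Lemma Cinfty_meval E f : {in Omega, f =1 ev E} -> Cinfty Omega f.
Proof.
have [e0 _] := andP e01.
move=> fE k; elim: k E f fE => [|k IH] E f fE.
  apply: (@Ck_ext _ _ _ (ev E)); first exact: open_Omega.
    by move=> p /fE.
  by split=> // p; exact: continuous_meval.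
apply: (@Ck_ext _ _ _ (ev E)); first exact: open_Omega.
  by move=> p /fE.
split; first by move=> p; exact: continuous_meval.
split.
- move=> p pO; split.
    exact: (@ex_derive _ _ _ _ _ _ _ (is_derive_meval_pos alpha_neq0 e0 aM bM E pO)).
  exact: (@ex_derive _ _ _ _ _ _ _ (is_derive_meval_time alpha_neq0 e0 aM bM E pO)).
- by apply: (IH (mdx E)); exact: dx_meval.
- by apply: (IH (mdt alpha E)); exact: dt_meval.
Qed.
End FixedEpsilon.

Variables (u0 v0 : Cfamily1 R).
(** Two bounds are kept apart: one for each e in (0, 1), which gives smoothness and the closed
    formulas, and one common to all small e, which gives the estimates. *)
Hypothesis fixed_bounded : forall e : R, 0 < e < 1 -> exists M,
  cont_bounded M (u0 e) /\ cont_bounded M (v0 e).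
Hypothesis unif_bounded : exists M, \forall e \near (0 : R)^'+,
  cont_bounded M (u0 e) /\ cont_bounded M (v0 e).

Lemma near_in01 : \forall e \near (0 : R)^'+, 0 < e < 1.
Proof.
near=> e; apply/andP; split; first by near: e; exact: nbhs_right_gt.
by near: e; apply: nbhs_right_lt.
Unshelve. all: by end_near. Qed.

Lemma moderate_meval (w : Cfamily R) E :
  (forall e, 0 < e < 1 -> {in Omega, w e =1 meval alpha e (u0 e) (v0 e) E}) ->
  moderate w.
Proof.
move=> wE; split.
  move=> e e01; have [M [aM bM]] := fixed_bounded e01.
  exact: (Cinfty_meval e01 aM bM (wE e e01)).
move=> K cK KO j l; have [A [t1 [t2 [t10 HK]]]] := compact_in_Omega cK KO.
have [M HM] := unif_bounded.
pose F := iter j (mdt alpha) (iter l mdx E).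
have [C C0 HC] := meval_bound M A t2 F alpha_neq0 t10.
(* The exponent must be positive even in degree 0; the additional factor 1/e is at least 1. *)
exists (mdegree F).+1%:R; first by rewrite ltr0n.
exists C; near=> e.
have e01 : 0 < e < 1 by near: e; exact: near_in01.
have [aM bM] : cont_bounded M (u0 e) /\ cont_bounded M (v0 e) by near: e.
have [e0 e1] := andP e01.
have ei : 1 <= e^-1 by rewrite invf_ge1// ltW.
have -> : e `^ (- (mdegree F).+1%:R) = e^-1 ^+ (mdegree F).+1.
  by rewrite powRN powR_mulrn ?ltW// exprVn.
apply: Linfty_norm_le => [|p Kp].
  by rewrite mulr_ge0// exprn_ge0// invr_ge0 ltW.
have [pA pt] := HK p Kp.
rewrite (iter_meval e01 aM bM _ _ (wE e e01)); last by rewrite inE; exact: KO.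
apply: (le_trans (HC _ _ _ _ e01 aM bM pA pt)).
by rewrite ler_wpM2l// ler_weXn2l.
Unshelve. all: by end_near. Qed.

Definition uexpr : @mexp R :=
  MMul MExp (MMul MInvTau
    (MAdd MX (MMul (MCst (- 1)) (MMom false 1)))).

Definition Vexpr : @mexp R := MMom true 0.

Lemma weightE e (p : R * R) y : 0 < e -> Omega p ->
  weight alpha u0 e p y =
  hopf e (u0 e) y * gauss_kernel (diffusivity_rate alpha e p.2) p.1 y.
Proof.
move=> e0 pO; have t0 := tau_gt0 alpha_neq0 pO.
rewrite /weight /hopf /gauss_kernel /theta -expRD /diffusivity_rate; congr expR.
by field; rewrite !gt_eqF.
Qed.

Lemma usolE e : 0 < e < 1 ->
  {in Omega, usol alpha u0 e =1 meval alpha e (u0 e) (v0 e) uexpr}.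
Proof.
move=> e01 [x t] /set_mem pO; have [M [aM bM]] := fixed_bounded e01.
have [e0 _] := andP e01; have t0 := tau_gt0 alpha_neq0 pO; rewrite /= in t0.
have s0 := diffusivity_rate_gt0 alpha_neq0 e0 pO; rewrite /= in s0.
have eg := exp_growth_hopf e0 aM.
rewrite /usol /=; congr (_ * _).
under eq_Rintegral do rewrite weightE//.
under [in X in _ / X]eq_Rintegral do rewrite weightE//.
rewrite /= -/(gauss_int _ _ x).
set g := hopf e (u0 e); set s := diffusivity_rate alpha e t.
have W0 : gauss_int g s x != 0.
  by rewrite gt_eqF// gauss_int_gt0//; exact: hopf_gt0.
transitivity (gauss_int (fun y => (tau alpha t)^-1 * (x * g y - y * g y)) s x
   / gauss_int g s x).
  by congr (_ / _); apply: eq_Rintegral => y _; ring.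
have eyg : exp_growth (fun y => y * g y).
  by apply: exp_growthM => //; exact: exp_growth_id.
have exg : exp_growth (fun y => x * g y) by auto with expgrowth.
rewrite gauss_intZ ?gauss_intB ?gauss_intZ//; last exact: exp_growthB.
rewrite /moment /gauss_mean /= -/g -/s.
have -> : (fun y : R => y ^+ 1 * moment_weight (v0 e) false y * g y) = (fun y => y * g y).
  by apply/funext => y; rewrite mulr1.
by field; rewrite W0 gt_eqF.
Qed.

Lemma VsolE e : 0 < e < 1 ->
  {in Omega, Vsol alpha u0 v0 e =1 meval alpha e (u0 e) (v0 e) Vexpr}.
Proof.
move=> e01 [x t] /set_mem pO; have [e0 _] := andP e01.
rewrite /Vsol /moment /gauss_mean /=.
under eq_Rintegral do rewrite weightE//.
under [in X in _ / X]eq_Rintegral do rewrite weightE//.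
rewrite /moment /gauss_mean /gauss_int /=; congr (_ / _).
by apply: eq_Rintegral => y _; rewrite mul1r mulrA.
Qed.

Lemma vsolE e : 0 < e < 1 ->
  {in Omega, vsol alpha u0 v0 e =1 meval alpha e (u0 e) (v0 e) (mdx Vexpr)}.
Proof.
move=> e01; have [M [aM bM]] := fixed_bounded e01.
exact: (dx_meval e01 aM bM (VsolE e01)).
Qed.
End Regularity.

(** * Pairing with test functions *)

Section PlaneIntegral.
Context {R : realType}.
Implicit Types (f g F : R * R -> R) (K U : set (R * R)).
Local Notation mu := (@lebesgue_measure R).
Local Notation m2 := (@mu2 R).
Local Notation mR := (measurableTypeR R).

(** The product sigma-algebra is generated by rectangles, so an open set is written as a countable
    union of rational squares; those not contained in U are replaced by the empty set. *)
Lemma open_measurable_plane U : open U -> measurable (U : set (mR * mR)).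
Proof.
move=> oU.
pose box (r : rat * rat * rat) : set (R * R) :=
  `](ratr r.1.1 - ratr r.2), (ratr r.1.1 + ratr r.2)[%classic `*`
  `](ratr r.1.2 - ratr r.2), (ratr r.1.2 + ratr r.2)[%classic.
pose B r := if `[< box r `<=` U >] then box r else set0.
have -> : U = \bigcup_r B r.
  apply/seteqP; split=> [[x t] Uxt|p [r _]]; last first.
    by rewrite /B; case: asboolP => // sub /sub.
  have /open_nbhs_nbhs/nbhs_ballP [d /= d0 hd] : open_nbhs (x, t) U by split.
  have [q] := @rat_in_itvoo R 0 (d / 2) ltac:(lra); rewrite in_itv/= => /andP[q0 qd].
  have [x' ] := @rat_in_itvoo R (x - ratr q) (x + ratr q) ltac:(lra).
  rewrite in_itv/= => /andP[x1 x2].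
  have [t' ] := @rat_in_itvoo R (t - ratr q) (t + ratr q) ltac:(lra).
  rewrite in_itv/= => /andP[t1 t2].
  exists ((x', t'), q) => //; rewrite /B; case: asboolP => [_|[]].
    by split; rewrite /= in_itv/=; apply/andP; split; lra.
  move=> [y s] [/=]; rewrite !in_itv/= => /andP[y1 y2] /andP[s1 s2].
  by apply: hd; split; rewrite /ball/= ltr_norml; apply/andP; split; lra.
apply: countable_bigcupT_measurable => [|r]; first exact: countableP.
by rewrite /B; case: ifP => // _; exact: measurableX.
Qed.

Lemma continuous_measurable_plane f : continuous f ->
  measurable_fun (setT : set (mR * mR)) f.
Proof.
move=> /continuousP cf; apply: (measurability _ (RGenOpens.measurableE R)).
move=> _ [_ [a [b ->] <-]]; rewrite setTI; apply: open_measurable_plane.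
exact/cf/interval_open.
Qed.

Lemma compact_in_square K : compact K -> exists2 A : R, 0 < A &
  K `<=` `[- A, A]%classic `*` `[- A, A]%classic.
Proof.
move=> cK; have [A [_ HA]] := compact_bounded cK.
exists (`|A| + 1); first by rewrite ltr_wpDl.
move=> p /(HA (`|A| + 1)) pA; have {}pA : `|p| <= `|A| + 1.
  by apply: pA; rewrite ltr_pwDr// ler_norm.
split; rewrite /= in_itv/= -ler_norml; apply: le_trans pA.
  by rewrite /Num.norm/= le_max lexx.
by rewrite /Num.norm/= le_max lexx orbT.
Qed.

Lemma bounded_compact_support f K : continuous f -> compact K ->
  (forall p, ~ K p -> f p = 0) -> exists2 C, 0 <= C & forall p, `|f p| <= C.
Proof.
move=> cf cK f0.
have /compact_bounded [B [_ HB]] := continuous_compact (continuous_subspaceT cf) cK.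
exists (`|B| + 1) => [|p]; first by rewrite addr_ge0.
have [Kp|nKp] := pselect (K p); last by rewrite f0// normr0 addr_ge0.
by apply: (HB (`|B| + 1)); [rewrite ltr_pwDr// ler_norm|exists p].
Qed.

Lemma integrable_compact_support f K : continuous f -> compact K ->
  (forall p, ~ K p -> f p = 0) -> m2.-integrable setT (EFin \o f).
Proof.
move=> cf cK f0; have [A A0 KA] := compact_in_square cK.
have [C C0 fC] := bounded_compact_support cf cK f0.
set S := (X in K `<=` X) in KA.
have mS : measurable (S : set (mR * mR)) by exact: measurableX.
have -> : EFin \o f = (EFin \o f) \_ S.
  apply/funext => p; rewrite patchE /=; case: ifPn => // /negP pS.
  by rewrite f0// => /KA/mem_set.
apply/(integrable_mkcond _ mS); apply: measurable_bounded_integrable => //.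
- pose I : set mR := `[- A, A]%classic; have mI : measurable I by exact: measurable_itv.
  apply: (@le_lt_trans _ _ (mu I * mu I)%E).
    by rewrite le_eqVlt; apply/orP; left; apply/eqP; exact: product_measure1E.
  rewrite /I !lebesgue_measure_itv/=.
  by rewrite lte_fin; case: ifP => _; rewrite -?EFinB -?EFinM ltry.
- by apply: measurable_funS (continuous_measurable_plane cf).
- exists C; split; first exact: num_real.
  by move=> D CD p _ /=; apply: (le_trans (fC p)); exact: ltW.
Qed.

(** Fubini with x integrated first: on each horizontal line, f is the derivative of a function that
    vanishes far away. *)
Lemma Rintegral_dx_eq0 F f K : (forall p : R * R,
    is_derive p.1 1 (fun x => F (x, p.2)) (f p)) ->
  continuous f -> compact K -> (forall p, ~ K p -> F p = 0) ->
  (forall p, ~ K p -> f p = 0) -> \int[m2]_p f p = 0.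
Proof.
move=> dF cf cK F0 f0; have [A A0 KA] := compact_in_square cK.
have intf := integrable_compact_support cf cK f0.
rewrite /Rintegral -integral21_prod_meas1//=.
under eq_integral => t _.
  rewrite (_ : fubini_G _ _ _ = 0%E); first over.
  have notK x : A < `|x| -> ~ K (x, t).
    move=> Ax /KA [/= + _]; rewrite in_itv/= -ler_norml leNgt; exact/negP/negPn.
  have clin : continuous (fun x => f (x, t)).
    move=> x; apply: (@cvg_comp _ _ _ (fun x => (x, t)) f _ (nbhs (x, t))).
      by apply: (@cvg_pair _ _ _ _ (nbhs x) (nbhs t)); [exact: cvg_id|exact: cvg_cst].
    exact: cf.
  have intl : mu.-integrable setT (EFin \o (fun x => f (x, t))).
    have -> : EFin \o (fun x => f (x, t)) = (EFin \o (fun x => f (x, t))) \_ `[- A, A].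
      apply/funext => x; rewrite patchE /=; case: ifPn => // /negP xA.
      rewrite f0//; apply: notK; rewrite ltNge; apply/negP => xA'; apply: xA.
      by rewrite inE/= in_itv/= -ler_norml.
    have mI : measurable (`[- A, A]%classic : set mR) by exact: measurable_itv.
    apply/(integrable_mkcond _ mI).
    apply: continuous_compact_integrable; first exact: segment_compact.
    exact: continuous_subspaceT.
  have lim (u : R^nat) : (forall n, `|u n| = n%:R) -> F (u n, t) @[n --> \oo] --> 0.
    move=> un; apply: cvg_near_cst; near=> n.
    apply/F0/notK; rewrite un; near: n.
    exact: nbhs_infty_gtr.
  rewrite /fubini_G -(fineK (integrable_fin_num measurableT intl)); congr _%:E.
  apply: (@Rintegral_derive_eq0 _ (fun x => F (x, t))) => //.
  - by move=> x; exact: (dF (x, t)).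
  - by apply: lim => n; rewrite normr_nat.
  - by apply: lim => n; rewrite normrN normr_nat.
by rewrite integral0.
Unshelve. all: by end_near. Qed.
End PlaneIntegral.

Section Pairing.
Context {R : realType}.
Implicit Types (f g psi : R * R -> R) (K U : set (R * R)).
Local Notation m2 := (@mu2 R).
Local Notation mR := (measurableTypeR R).

Lemma Cinfty_iter_dx psi n : Cinfty setT psi -> Cinfty setT (iter n dx psi).
Proof.
move=> cpsi; elim: n => [//|n IH] k /=.
by have [_ []] := IH k.+1.
Qed.

Lemma iter_dx_eq0 U psi n : open U -> (forall p, U p -> psi p = 0) ->
  forall p, U p -> iter n dx psi p = 0.
Proof.
move=> oU psi0; elim: n => [//|n IH] p Up /=.
have E : {in U, iter n dx psi =1 (fun=> 0)} by move=> q /set_mem /IH.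
rewrite (eq_dx_on oU E) ?mem_set// /dx.
exact: derive1_is_derive (is_derive1_cst 0 p.1).
Qed.

(** Continuity of g is known only in U. At a point outside U the product vanishes nearby, because
    the complement of the compact K is open. *)
Lemma continuous_mul_compact_support K U g psi : compact K -> K `<=` U ->
  open U -> (forall p, U p -> {for p, continuous g}) -> continuous psi ->
  (forall p, ~ K p -> psi p = 0) -> continuous (fun p => g p * psi p).
Proof.
move=> cK KU oU cg cpsi psi0 p.
have [Up|nUp] := pselect (U p).
  by apply: cvgM; [exact: cg|exact: cpsi].
have nKp : (~` K) p by move=> /KU.
have oK : open (~` K).
  by apply: closed_openC; apply: compact_closed => //; exact: hausdorff_prod.
apply: cvg_near_cst.
have /= := open_nbhs_nbhs (conj oK nKp).
by apply: filterS => q nKq; rewrite !psi0// !mulr0.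
Qed.

Section ByParts.
Variables (alpha e M : R) (a b : R -> R).
Hypotheses (alpha_neq0 : alpha != 0) (e01 : 0 < e < 1).
Hypotheses (aM : cont_bounded M a) (bM : cont_bounded M b).
Local Notation ev := (meval alpha e a b).
Variables (phi : R * R -> R).
Hypothesis test_phi : test_function phi.
Let K := closure [set p | phi p != 0].
Let cphi : Cinfty setT phi. Proof. by case: test_phi. Qed.
Let cK : compact K. Proof. by case: test_phi. Qed.
Let KO : K `<=` Omega. Proof. by case: test_phi. Qed.

Let oK : open (~` K).
Proof. by apply: closed_openC; exact: closed_closure. Qed.

Lemma iter_dx_test_eq0 n p : ~ K p -> iter n dx phi p = 0.
Proof.
move=> nKp; apply: (@iter_dx_eq0 (~` K)) => // q nKq.
by apply/eqP; apply: contrapT => /negP q0; apply: nKq; exact: subset_closure.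
Qed.

Lemma continuous_iter_dx_test n : continuous (iter n dx phi).
Proof. by move=> p; have [+ _] := Cinfty_iter_dx n cphi 0; apply. Qed.

Lemma is_derive_iter_dx_test n (p : R * R) :
  is_derive p.1 1 (fun x => iter n dx phi (x, p.2)) (iter n.+1 dx phi p).
Proof.
apply: derivable_is_derive1.
by have [_ [+ _ _]] := Cinfty_iter_dx n cphi 1; move=> /(_ p I) [].
Qed.

Lemma continuous_meval_test E n : continuous (fun p => ev E p * iter n dx phi p).
Proof.
apply: (continuous_mul_compact_support cK KO open_Omega).
- by move=> p; exact: (continuous_meval alpha_neq0 e01 aM bM).
- exact: continuous_iter_dx_test.
- exact: iter_dx_test_eq0.
Qed.

Lemma integrable_meval_test E n :
  m2.-integrable setT (EFin \o (fun p => ev E p * iter n dx phi p)).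
Proof.
apply: (@integrable_compact_support _ _ K) => [||p nKp].
- exact: continuous_meval_test.
- exact: cK.
by rewrite iter_dx_test_eq0// mulr0.
Qed.

Lemma pairing_by_parts E n :
  \int[m2]_p (ev (mdx E) p * iter n dx phi p) =
  - \int[m2]_p (ev E p * iter n.+1 dx phi p).
Proof.
apply/eqP; rewrite -addr_eq0 -RintegralD//; [|exact: integrable_meval_test..].
apply/eqP; apply: (@Rintegral_dx_eq0 _ (fun p => ev E p * iter n dx phi p) _ K) => //.
- move=> p; have [pO|npO] := pselect (Omega p).
    have [e0 _] := andP e01.
    have := is_derive1M (is_derive_meval_pos alpha_neq0 e0 aM bM E pO)
      (is_derive_iter_dx_test n p).
    by rewrite -surjective_pairing.
  (* Membership in [Omega] depends on t alone, so the whole horizontal line through p misses the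
     support and the product is 0 along it. *)
  have nK x : ~ K (x, p.2) by move=> /KO.
  have nKp : ~ K p by move=> /KO.
  rewrite !iter_dx_test_eq0// !mulr0 addr0.
  under eq_fun do rewrite iter_dx_test_eq0// mulr0.
  exact: is_derive1_cst.
- move=> p; apply: cvgD; exact: continuous_meval_test.
- by move=> p nKp; rewrite iter_dx_test_eq0// mulr0.
- by move=> p nKp; rewrite !iter_dx_test_eq0// !mulr0 addr0.
Qed.

Lemma pairing_iter_by_parts E n k :
  \int[m2]_p (ev (iter n mdx E) p * iter k dx phi p) =
  (-1) ^+ n * \int[m2]_p (ev E p * iter (n + k) dx phi p).
Proof.
elim: n k => [|n IH] k; first by rewrite expr0 mul1r.
by rewrite iterS pairing_by_parts IH addnS exprS mulN1r mulNr.
Qed.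
End ByParts.

(* Each of the [n] derivatives goes to the test function, and the factor [e]
   remains in front of a bounded pairing. *)
Lemma cvg0_meval alpha (u0 v0 : Cfamily1 R) (w : Cfamily R) E n :
  alpha != 0 ->
  (exists M, \forall e \near (0 : R)^'+, cont_bounded M (u0 e) /\ cont_bounded M (v0 e)) ->
  mdegree E = 0%N ->
  (forall e, 0 < e < 1 ->
    {in Omega, forall p, w e p = e * meval alpha e (u0 e) (v0 e) (iter n mdx E) p}) ->
  cvg0_distributions w.
Proof.
move=> al0 [M HM] E0 wE phi tphi; have [cphi cK KO] := tphi.
have [A [t1 [t2 [t10 HK]]]] := compact_in_Omega cK KO.
have [C C0 HC] := meval_bound M A t2 E al0 t10.
set K := closure _ in cK KO HK.
pose psi := iter n dx phi.
have psi0 p : ~ K p -> psi p = 0 by exact: iter_dx_test_eq0.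
have intpsi : m2.-integrable setT (EFin \o (fun p => `|psi p|)).
  apply: (@integrable_compact_support _ _ K) => [p||p nKp]; last by rewrite psi0 ?normr0.
    by apply: cvg_norm; exact: continuous_iter_dx_test.
  exact: cK.
pose L := \int[m2]_p `|psi p|.
have L0 : 0 <= L by apply: Rintegral_ge0.
have bound : \forall e \near (0 : R)^'+,
    `|\int[m2]_(p in Omega) (w e p * phi p)| <= e * (C * L).
  near=> e.
  have e01 : 0 < e < 1 by near: e; exact: near_in01.
  have [aM bM] : cont_bounded M (u0 e) /\ cont_bounded M (v0 e) by near: e.
  have [e0 _] := andP e01.
  set ev := meval alpha e (u0 e) (v0 e) in wE *.
  have -> : \int[m2]_(p in Omega) (w e p * phi p) =
      \int[m2]_p (e * (ev (iter n mdx E) p * iter 0 dx phi p)).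
    rewrite Rintegral_mkcond; apply: eq_Rintegral => p _; rewrite patchE.
    case: ifPn => [pO|/negP pO]; first by rewrite wE// mulrA.
    rewrite (iter_dx_test_eq0 0) ?mulr0// => /KO pO'; apply: pO.
    by rewrite inE.
  rewrite RintegralZl//; last exact: (integrable_meval_test al0 e01 aM bM).
  rewrite (pairing_iter_by_parts al0 e01 aM bM)// addn0.
  rewrite normrM gtr0_norm// ler_wpM2l ?(ltW e0)// normrM normrX normrN1 expr1n mul1r.
  have intE := integrable_meval_test al0 e01 aM bM tphi E n.
  apply: (le_trans (le_normr_Rintegral _ intE)) => //.
  rewrite -RintegralZl//; apply: le_Rintegral => //.
  - have := integrable_abse intE; apply: eq_integrable => //.
  - have := integrableZl measurableT C intpsi; apply: eq_integrable => //.
  - move=> p _; rewrite normrM.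
    have [Kp|nKp] := pselect (K p); last by rewrite -/psi psi0 ?normr0 ?mulr0.
    rewrite ler_wpM2r//; have [pA pt] := HK p Kp.
    by have := HC _ _ _ _ e01 aM bM pA pt; rewrite E0 mulr1.
apply/norm_cvg0P; apply: (@squeeze_cvgr _ _ _ _ (cst 0) (fun e => e * (C * L))).
- by apply: filterS bound => e ->; rewrite normr_ge0.
- exact: cvg_cst.
- rewrite -[X in _ --> X](mul0r (C * L)).
  by apply: cvgM; [exact: cvg_at_right_filter cvg_id|exact: cvg_cst].
Unshelve. all: by end_near. Qed.
End Pairing.

(** * Association and initial values *)

Section Classes.
Context {R : realType}.
Implicit Types (w z : Cfamily R) (c d : set (Cfamily R)).

Lemma null_family0 : null_family (0 : Cfamily R).
Proof.
have dx0 : dx (fun=> 0) = (fun=> 0) :> (R * R -> R).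
  by apply/funext => p; exact: derive1_is_derive (is_derive1_cst 0 p.1).
have dt0 : dt (fun=> 0) = (fun=> 0) :> (R * R -> R).
  by apply/funext => p; exact: derive1_is_derive (is_derive1_cst 0 p.2).
split=> [e _ k|K _ _ j l M M0].
  rewrite (_ : (0 : Cfamily R) e = fun=> 0)//.
  elim: k => [|k IH]; first by split=> // p _; exact: cvg_cst.
  split; first by move=> p _; exact: cvg_cst.
  split; [|by rewrite dx0|by rewrite dt0].
  by move=> p _; split; exact: derivable_cst.
exists 0; apply: nearW => e; rewrite mul0r.
have -> : iter j dt (iter l dx ((0 : Cfamily R) e)) = (fun=> 0).
  rewrite (_ : iter l _ _ = fun=> 0); last by elim: l => [//|l IH]; rewrite iterS IH.
  by elim: j => [//|j IH]; rewrite iterS IH.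
by apply: Linfty_norm_le => // p _; rewrite normr0.
Qed.

Lemma gclass_refl w : gclass w w.
Proof. by exists 0; [exact: null_family0|rewrite addr0]. Qed.

Lemma mem_glift1 F c w : c w -> glift1 F c (F w).
Proof. by move=> cw; exists w => //; exact: gclass_refl. Qed.

Lemma mem_glift2 F c d w z : c w -> d z -> glift2 F c d (F w z).
Proof. by move=> cw dz; exists w => //; exists z => //; exact: gclass_refl. Qed.

Lemma associated_gzero c w : c w -> cvg0_distributions w -> associated c gzero.
Proof.
move=> cw cvgw; exists w, 0; split=> //; first exact: gclass_refl.
by under eq_fun do under eq_fun do rewrite subr0.
Qed.
End Classes.

Section Association.
Context {R : realType} (alpha : R) (u0 v0 : Cfamily1 R).
Hypothesis alpha_neq0 : alpha != 0.
Hypothesis fixed_bounded : forall e : R, 0 < e < 1 -> exists M,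
  cont_bounded M (u0 e) /\ cont_bounded M (v0 e).
Hypothesis unif_bounded : exists M, \forall e \near (0 : R)^'+,
  cont_bounded M (u0 e) /\ cont_bounded M (v0 e).
Local Notation u := (usol alpha u0).
Local Notation v := (vsol alpha u0 v0).

(** The factor exp(-alpha t) is constant in x, so it can be placed under both x-derivatives. The
    identity that remains holds with the moments treated as independent variables, hence the closing
    [field]. *)
Lemma associated_usol : associated
  (gadd (gadd (gdt (gclass u)) (gdx (gscale 2^-1 (gmul (gclass u) (gclass u)))))
     (gscale alpha (gclass u))) gzero.
Proof.
have cu := gclass_refl u.
apply: associated_gzero.
  apply: mem_glift2; last exact: (mem_glift1 _ cu).
  apply: mem_glift2; first exact: (mem_glift1 _ cu).
  by apply: mem_glift1; apply: mem_glift1; exact: (mem_glift2 _ cu cu).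
apply: (@cvg0_meval _ alpha u0 v0 _ (MMul MExp (@uexpr R)) 2) => // e e01 p pO.
have [M [aM bM]] := fixed_bounded e01.
have uE := usolE alpha_neq0 fixed_bounded e01.
rewrite (dt_meval alpha_neq0 e01 aM bM uE pO).
have u2E : {in Omega, (fun p => 2^-1 * (u e p * u e p)) =1
    meval alpha e (u0 e) (v0 e) (MMul (MCst 2^-1) (MMul (@uexpr R) (@uexpr R)))}.
  by move=> q qO; rewrite /= !uE.
rewrite (dx_meval alpha_neq0 e01 aM bM u2E pO) (uE p pO) /=.
have [e0 _] := andP e01; move/set_mem: pO => pO.
have t0 := tau_gt0 alpha_neq0 pO.
by field; rewrite !gt_eqF.
Qed.

(** Three derivatives of the bounded V are used instead of two of v, for which no bound uniform in e
    is available. *)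
Lemma associated_vsol : associated
  (gadd (gdt (gclass v)) (gdx (gmul (gclass u) (gclass v)))) gzero.
Proof.
have cu := gclass_refl u; have cv := gclass_refl v.
apply: associated_gzero.
  apply: mem_glift2; first exact: (mem_glift1 _ cv).
  by apply: mem_glift1; exact: (mem_glift2 _ cu cv).
apply: (@cvg0_meval _ alpha u0 v0 _ (MMul MExp (@Vexpr R)) 3) => // e e01 p pO.
have [M [aM bM]] := fixed_bounded e01.
have uE := usolE alpha_neq0 fixed_bounded e01.
have vE := vsolE alpha_neq0 fixed_bounded e01.
rewrite (dt_meval alpha_neq0 e01 aM bM vE pO).
have uvE : {in Omega, (fun p => u e p * v e p) =1
    meval alpha e (u0 e) (v0 e) (MMul (@uexpr R) (mdx (@Vexpr R)))}.
  by move=> q qO; rewrite uE// vE.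
rewrite (dx_meval alpha_neq0 e01 aM bM uvE pO) /=.
have [e0 _] := andP e01; move/set_mem: pO => pO.
have t0 := tau_gt0 alpha_neq0 pO.
by field; rewrite !gt_eqF.
Qed.
End Association.

Section InitialValues.
Context {R : realType} (alpha e M : R) (a b : R -> R).
Hypotheses (alpha_neq0 : alpha != 0) (e01 : 0 < e < 1).
Hypotheses (aM : cont_bounded M a) (bM : cont_bounded M b).
Local Notation mean q p :=
  (gauss_mean (hopf e a) q (diffusivity_rate alpha e p.2) p.1).

Let e0 : 0 < e. Proof. by case/andP: e01. Qed.
Let g_growth : exp_growth (hopf e a). Proof. exact: exp_growth_hopf aM. Qed.
Let drift_growth : exp_growth (fun y => a y / (2 * e)).
Proof. by apply: exp_growthM (exp_growth_bounded aM) (exp_growth_cst _). Qed.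
Let drift_bound y : `|a y / (2 * e)| <= M / (2 * e).
Proof.
have e20 : 0 < (2 * e)^-1 by rewrite invr_gt0; have := e0; lra.
by rewrite normrM [`|_^-1|]gtr0_norm// ler_wpM2r ?(ltW e20)// aM.2.
Qed.

(** A Chebyshev argument. The point p tends to (x, 0) freely in the half-plane, so the second moment
    is taken about the moving abscissa and then compared with x. *)
Lemma cvg_mean_initial q A (x : R) : continuous q ->
  (forall y, `|q y| <= A * (1 + `|y|)) ->
  mean q p @[p --> within Omega (nbhs (x, 0 : R))] --> q x.
Proof.
move=> cq qA; have eq := exp_growth_of_lin cq qA.
have A0 : 0 <= A by have := qA 0; rewrite normr0 addr0 mulr1; apply: le_trans.
apply/cvgrPdist_lt => eps eps0.
have /cvgrPdist_lt/(_ (eps / 2)) := cq x; case; first by lra.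
move=> d /= d0 hd.
(* For z = |x - y| >= d, linear growth gives at most A (2 + 2|x| + z), and 1 <= z^2/d^2, z <=
   z^2/d. *)
pose C := A * ((2 + 2 * `|x|) / d ^+ 2 + d^-1).
have C0 : 0 <= C.
  by rewrite mulr_ge0// addr_ge0 ?invr_ge0 ?(ltW d0)// divr_ge0 ?sqr_ge0// addr_ge0// mulr_ge0.
(* Linear growth beyond distance [d] is absorbed by the quadratic term, whose
   mean, the second moment, tends to 0. *)
have quad y : `|q y - q x| <= eps / 2 + C * (y - x) ^+ 2.
  have [yd|yd] := ltP `|x - y| d.
    have : `|q x - q y| < eps / 2 by apply: hd.
    rewrite distrC => /ltW h; apply: (le_trans h).
    by rewrite lerDl mulr_ge0// sqr_ge0.
  apply: (@le_trans _ _ (C * (y - x) ^+ 2)); last by rewrite lerDr; lra.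
  apply: (le_trans (ler_normB _ _)); apply: (le_trans (lerD (qA y) (qA x))).
  rewrite -mulrDr /C -mulrA ler_wpM2l//.
  rewrite -[(y - x) ^+ 2](real_normK (num_real _)) distrC.
  set z := `|x - y| in yd *.
  have yz : `|y| <= `|x| + z by rewrite /z; have := ler_normB x (x - y); rewrite subKr.
  have h1 : 1 <= z ^+ 2 / d ^+ 2.
    rewrite ler_pdivlMr ?exprn_gt0// mul1r lerXn2r// nnegrE ?(ltW d0)//.
    exact: normr_ge0.
  have h2 : z <= z ^+ 2 / d by rewrite ler_pdivlMr// expr2 ler_wpM2l// /z.
  rewrite mulrDl [d^-1 * _]mulrC mulrAC -mulrA.
  have x0 := normr_ge0 x; have : (2 + 2 * `|x|) <= (2 + 2 * `|x|) * (z ^+ 2 / d ^+ 2).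
    by rewrite ler_peMr//; lra.
  by lra.
(* The first two terms are the second moment bound 2/s + (H/(2s))^2 at s = 1/(4 e tau), H = M/(2e);
   the factor 2 comes from (z - x)^2 <= 2 (y - x)^2 + 2 (z - y)^2. *)
pose B (p : R * R) := 2 * C * (8 * e * tau alpha p.2 + (M * tau alpha p.2) ^+ 2
   + (p.1 - x) ^+ 2).
have Bcvg : B p @[p --> (x, 0 : R)] --> (0 : R).
  have ctau : tau alpha p.2 @[p --> (x, 0 : R)] --> (0 : R).
    apply: (@cvg_comp _ _ _ snd (tau alpha) _ (nbhs (0 : R))); first exact: cvg_snd.
    have : {for (0 : R), continuous (tau alpha)} by apply: continuous_tau.
    by rewrite /prop_for /continuous_at tau0.
  have cx : p.1 - x @[p --> (x, 0 : R)] --> (0 : R).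
    by rewrite -(subrr x); apply: cvgB; [exact: cvg_fst|exact: cvg_cst].
  have sq f : f p @[p --> (x, 0 : R)] --> (0 : R) -> f p ^+ 2 @[p --> (x, 0 : R)] --> (0 : R).
    by move=> cf; rewrite -[X in _ --> X](mulr0 (0 : R)); exact: cvgM.
  rewrite -[X in _ --> X](_ : 2 * C * (8 * e * 0 + 0 + 0) = 0); last by ring.
  apply: cvgM; first exact: cvg_cst.
  apply: cvgD; last exact: (sq (fun p => p.1 - x) cx).
  apply: cvgD; first by apply: cvgM; [exact: cvg_cst|exact: ctau].
  apply: (sq (fun p => M * tau alpha p.2)); rewrite -[X in _ --> X](mulr0 M);
    by apply: cvgM; [exact: cvg_cst|exact: ctau].
have Bsmall : \forall p \near (x, 0 : R), `|0 - B p| < eps / 2.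
  by move/cvgrPdist_lt: Bcvg; apply; lra.
rewrite near_withinE; apply: filterS Bsmall => -[y t]; rewrite sub0r normrN => By pO.
have t0 := tau_gt0 alpha_neq0 pO; rewrite /= in t0 *.
have s0 := diffusivity_rate_gt0 alpha_neq0 e0 pO; rewrite /= in s0.
set s := diffusivity_rate alpha e t in s0 *.
have eqx : exp_growth (fun y => q y - q x) by auto with expgrowth.
have ez : exp_growth (fun z => (z - y) ^+ 2) by apply: exp_growthX; auto with expgrowth.
have E1 : gauss_mean (hopf e a) q s y - q x = gauss_mean (hopf e a) (fun z => q z - q x) s y.
  by rewrite gauss_meanB ?gauss_mean_cst//; [exact: hopf_gt0|exact: exp_growth_cst].
rewrite distrC E1.
have eb : exp_growth (fun z => (eps / 2 + 2 * C * (y - x) ^+ 2) + 2 * C * (z - y) ^+ 2).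
  by auto with expgrowth.
apply: (@le_lt_trans _ _ (gauss_mean (hopf e a)
    (fun z => (eps / 2 + 2 * C * (y - x) ^+ 2) + 2 * C * (z - y) ^+ 2) s y)).
  apply: ler_norm_gauss_mean => //; first exact: hopf_gt0.
  move=> z; apply: (le_trans (quad z)).
  have sqz : (z - x) ^+ 2 <= 2 * (y - x) ^+ 2 + 2 * (z - y) ^+ 2.
    by have := sqr_ge0 ((z - y) - (y - x)); nra.
  by have := ler_wpM2l C0 sqz; lra.
rewrite gauss_meanD ?gauss_meanZ ?gauss_mean_cst//; try exact: hopf_gt0;
  try by auto with expgrowth.
have := @gauss_moment_bound _ _ g_growth (hopf_gt0 e a) _ drift_growth
  (fun y => is_derive_hopf e y aM.1) _ drift_bound 1 s y s0.
rewrite expr1 [1.*2]/=.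
have -> : 2 / s + (M / (2 * e) / (2 * s)) ^+ 2 = 8 * e * tau alpha t + (M * tau alpha t) ^+ 2.
  by rewrite /s /diffusivity_rate; field; rewrite !gt_eqF.
move=> mom; move: By; rewrite /B/= => /(le_lt_trans (ler_norm _)) By.
have : 2 * C * gauss_mean (hopf e a) (fun z => (z - y) ^+ 2) s y <=
    2 * C * (8 * e * tau alpha t + (M * tau alpha t) ^+ 2).
  by rewrite ler_wpM2l// mulr_ge0.
lra.
Qed.

Let mean_by_parts (Q dQ : R -> R) (p : R * R) :
  (forall y : R, is_derive y 1 Q (dQ y)) -> exp_growth Q -> exp_growth dQ ->
  Omega p ->
  2 * diffusivity_rate alpha e p.2 * (mean (fun y => y * Q y) p - p.1 * mean Q p) =
  mean dQ p - (2 * e)^-1 * mean (fun y => Q y * a y) p.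
Proof.
move=> derQ eQ edQ pO; have s0 := diffusivity_rate_gt0 alpha_neq0 e0 pO.
have ea := exp_growth_bounded aM.
have eyQ : exp_growth (fun y => y * Q y) by apply: exp_growthM => //; exact: exp_growth_id.
have := gauss_mean_by_parts g_growth drift_growth
  (fun y => is_derive_hopf e y aM.1) p.1 derQ eQ edQ s0.
have -> : (fun y => Q y * (a y / (2 * e))) = (fun y => (2 * e)^-1 * (Q y * a y)).
  by apply/funext => y; ring.
have -> : (fun y => (y - p.1) * Q y) = (fun y => y * Q y - p.1 * Q y).
  by apply/funext => y; ring.
rewrite gauss_meanB ?gauss_meanZ//; by auto with expgrowth.
Qed.

(** The case Q = 1: the mean of y differs from x by -tau E[a]. *)
Let mean_drift (p : R * R) : Omega p ->
  2 * diffusivity_rate alpha e p.2 * (mean id p - p.1) = - ((2 * e)^-1 * mean a p).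
Proof.
move=> pO; have s0 := diffusivity_rate_gt0 alpha_neq0 e0 pO.
have := mean_by_parts (is_derive1_cst 1) (exp_growth_cst 1) (exp_growth_cst 0) pO.
rewrite !gauss_mean_cst//; try exact: hopf_gt0.
rewrite mulr1 sub0r.
under eq_fun do rewrite mulr1.
by under [in X in _ = X -> _]eq_fun do rewrite mul1r.
Qed.

(** This removes the factor 1/tau of u, which is singular at t = 0. *)
Lemma meval_uexpr_mean p : Omega p ->
  meval alpha e a b (@uexpr R) p = expR (- alpha * p.2) * mean a p.
Proof.
move=> pO; have t0 := tau_gt0 alpha_neq0 pO; have D := mean_drift pO.
rewrite /= /moment; congr (_ * _).
have -> : (fun y : R => y ^+ 1 * moment_weight b false y) = id.
  by apply/funext => y; rewrite mulr1.
have -> : mean a p = - (2 * e) *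
    (2 * diffusivity_rate alpha e p.2 * (mean id p - p.1)).
  by rewrite D; field; rewrite gt_eqF.
set m := mean id p; rewrite /diffusivity_rate.
by field; rewrite !gt_eqF.
Qed.

(** As an x-derivative, v is 2 s times the covariance of y and the primitive p of b, and s blows up
    at t = 0. Integrating by parts with Q = p and with Q = 1 trades this for the covariance of p and
    a. *)
Lemma meval_vexpr_mean p : Omega p ->
  meval alpha e a b (mdx (@Vexpr R)) p = mean b p +
    (2 * e)^-1 * (mean (primitive0 b) p * mean a p
                  - mean (fun y => primitive0 b y * a y) p).
Proof.
move=> pO; have t0 := tau_gt0 alpha_neq0 pO.
have eb := exp_growth_primitive0 bM.
have D := mean_drift pO.
have D' := mean_by_parts (fun y => is_derive_primitive0 y bM.1) eb
  (exp_growth_bounded bM) pO.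
case: p pO t0 D D' => x t pO t0 D D'.
have cov := meval_mcov1 alpha e a b true 0 x t.
have -> : meval alpha e a b (mdx (@Vexpr R)) (x, t) =
    2 * diffusivity_rate alpha e t * meval alpha e a b (mcov true 0 1) (x, t).
  rewrite /= /diffusivity_rate; move: (moment _ _ _ _ _ _ _ + _) => c.
  by field; rewrite !gt_eqF.
have w0 : (fun y : R => y ^+ 0 * moment_weight b true y) = primitive0 b.
  by apply/funext => y; rewrite mul1r.
have w1 : (fun y : R => y * (y ^+ 0 * moment_weight b true y)) =
    (fun y => y * primitive0 b y).
  by apply/funext => y; rewrite mul1r.
rewrite cov w0 w1 /= in D D' *.
set s := diffusivity_rate alpha e t in D D' *.
move: D D'; set m1 := gauss_mean _ id _ _; set mb := gauss_mean _ b _ _.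
set ma := gauss_mean _ a _ _; set mp := gauss_mean _ (primitive0 b) _ _.
set mpa := gauss_mean _ (fun y => primitive0 b y * a y) _ _.
set myp := gauss_mean _ (fun y => y * _) _ _ => D D'.
rewrite (_ : 2 * s * (myp - mp * m1) =
  2 * s * (myp - x * mp) - mp * (2 * s * (m1 - x))); last by ring.
by rewrite D D'; ring.
Qed.

Lemma cvg_uexpr_initial (x : R) :
  meval alpha e a b (@uexpr R) p @[p --> within Omega (nbhs (x, 0 : R))] --> a x.
Proof.
have ca : mean a p @[p --> within Omega (nbhs (x, 0 : R))] --> a x.
  apply: (@cvg_mean_initial _ M); first exact: aM.1.
  by move=> y; apply: (le_trans (aM.2 y)); rewrite ler_peMr ?lerDl// (le_trans _ (aM.2 0)).
have cE : expR (- alpha * p.2) @[p --> within Omega (nbhs (x, 0 : R))] --> (1 : R).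
  apply: cvg_within_filter.
  have E1 : expR (- alpha * 0) = 1 :> R by rewrite mulr0 expR0.
  rewrite -E1.
  apply: (@cvg_comp _ _ _ (fun p : R * R => - alpha * p.2) expR _ (nbhs (- alpha * 0))).
    by apply: cvgM; [exact: cvg_cst|exact: cvg_snd].
  exact: continuous_expR.
rewrite -[a x]mul1r; apply: cvg_trans (cvgM cE ca).
apply: near_eq_cvg; rewrite near_withinE; apply: nearW => p pO.
by rewrite meval_uexpr_mean.
Qed.

Lemma cvg_vexpr_initial (x : R) :
  meval alpha e a b (mdx (@Vexpr R)) p @[p --> within Omega (nbhs (x, 0 : R))]
  --> b x.
Proof.
have M0 : 0 <= M by apply: le_trans (aM.2 0).
have ca : mean a p @[p --> within Omega (nbhs (x, 0 : R))] --> a x.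
  apply: (@cvg_mean_initial _ M); first exact: aM.1.
  by move=> y; apply: (le_trans (aM.2 y)); rewrite ler_peMr ?lerDl.
have cb : mean b p @[p --> within Omega (nbhs (x, 0 : R))] --> b x.
  apply: (@cvg_mean_initial _ M); first exact: bM.1.
  by move=> y; apply: (le_trans (bM.2 y)); rewrite ler_peMr ?lerDl.
have cp : mean (primitive0 b) p @[p --> within Omega (nbhs (x, 0 : R))]
    --> primitive0 b x.
  apply: (@cvg_mean_initial _ M); first exact: continuous_primitive0 bM.1.
  by move=> y; apply: (le_trans (primitive0_bound bM.1 bM.2 y)); rewrite ler_wpM2l// lerDr.
have cpa : mean (fun y => primitive0 b y * a y) p
    @[p --> within Omega (nbhs (x, 0 : R))] --> primitive0 b x * a x.
  apply: (@cvg_mean_initial _ (M * M)).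
    by move=> y; apply: cvgM; [exact: continuous_primitive0 bM.1 _|exact: aM.1].
  move=> y; rewrite normrM mulrAC; apply: ler_pM => //; last exact: aM.2.
  by apply: (le_trans (primitive0_bound bM.1 bM.2 y)); rewrite ler_wpM2l// lerDr.
(* Concentration at x makes the covariance of the primitive and a tend to 0; its factor 1/(2e) is
   harmless since e is fixed. *)
have -> : b x = b x + (2 * e)^-1 * (primitive0 b x * a x - primitive0 b x * a x).
  by rewrite subrr mulr0 addr0.
apply: cvg_trans (cvgD cb (cvgM (cvg_cst (2 * e)^-1) (cvgB (cvgM cp ca) cpa))).
apply: near_eq_cvg; rewrite near_withinE; apply: nearW => p pO.
by rewrite meval_vexpr_mean.
Qed.
End InitialValues.

Lemma cont_bounded_le (R : realType) (M N : R) a : M <= N ->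
  cont_bounded M a -> cont_bounded N a.
Proof. by move=> MN [ca aM]; split=> // y; exact: le_trans (aM y) MN. Qed.

Lemma Cinfty1_continuous (R : realType) (g : R -> R) : Cinfty1 g -> continuous g.
Proof.
move=> cg x; apply/differentiable_continuous/derivable1_diffP.
exact: cg 0%N x.
Qed.

Lemma near_cont_bounded (R : realType) (w : Cfamily1 R) :
  (forall e, 0 < e < 1 -> continuous (w e)) ->
  bigO_at0 (fun e => Linfty_norm1 setT (derive1n 0 (w e))) (fun e => e ^- 0) ->
  exists M, \forall e \near (0 : R)^'+, cont_bounded M (w e).
Proof.
move=> cw [C HC]; exists C; near=> e.
have e01 : 0 < e < 1 by near: e; exact: near_in01.
split; first exact: cw.
apply: Linfty_norm1_bound; first exact: cw.
have : (Linfty_norm1 setT (derive1n 0 (w e)) <= (C * e ^- 0)%:E)%E by near: e.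
by rewrite expr0 invr1 mulr1.
Unshelve. all: by end_near. Qed.

Unset Implicit Arguments.

Theorem theorem4p3 (R : realType) (alpha : R) (u0 v0 : Cfamily1 R)
    (u0lim v0lim : R -> R)
    (alpha_neq0 : alpha != 0)
    (u0_moderate : moderate1 u0) (v0_moderate : moderate1 v0)
    (u0_bounded : forall e : R, 0 < e < 1 -> exists C : R, forall x, `|u0 e x| <= C)
    (v0_bounded : forall e : R, 0 < e < 1 -> exists C : R, forall x, `|v0 e x| <= C)
    (u0_bigO : forall j : nat,
      bigO_at0 (fun e => Linfty_norm1 setT (derive1n j (u0 e))) (fun e => e ^- j))
    (v0_bigO : forall j : nat,
      bigO_at0 (fun e => Linfty_norm1 setT (derive1n j (v0 e))) (fun e => e ^- j))
    (u0_cvg : {ae lebesgue_measure, forall x : R,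
      u0 e x @[e --> 0^'+] --> u0lim x})
    (v0_cvg : {ae lebesgue_measure, forall x : R,
      v0 e x @[e --> 0^'+] --> v0lim x}) :
  let u := usol alpha u0 in
  let v := vsol alpha u0 v0 in
  [/\ moderate u, moderate v, weak_solution alpha (gclass u) (gclass v),
      initial_condition u u0 & initial_condition v v0].
Proof.
move=> u v.
have cu e : 0 < e < 1 -> continuous (u0 e).
  by move=> e01; apply/Cinfty1_continuous/u0_moderate.1.
have cv e : 0 < e < 1 -> continuous (v0 e).
  by move=> e01; apply/Cinfty1_continuous/v0_moderate.1.
have fixed e : 0 < e < 1 -> exists M, cont_bounded M (u0 e) /\ cont_bounded M (v0 e).
  move=> e01; have [A HA] := u0_bounded e e01; have [B HB] := v0_bounded e e01.
  exists (Num.max A B); split; split; [exact: cu| |exact: cv|] => y.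
    by rewrite le_max HA.
  by rewrite le_max HB orbT.
have unif : exists M, \forall e \near (0 : R)^'+,
    cont_bounded M (u0 e) /\ cont_bounded M (v0 e).
  have [A HA] := near_cont_bounded cu (u0_bigO 0%N).
  have [B HB] := near_cont_bounded cv (v0_bigO 0%N).
  exists (Num.max A B); apply: filterS2 HA HB => e HA HB.
  by split; [apply: cont_bounded_le HA|apply: cont_bounded_le HB]; rewrite le_max lexx ?orbT.
have uE e (e01 : 0 < e < 1) := usolE alpha_neq0 fixed e01.
have vE e (e01 : 0 < e < 1) := vsolE alpha_neq0 fixed e01.
have mu : moderate u by exact: (moderate_meval alpha_neq0 fixed unif uE).
have mv : moderate v by exact: (moderate_meval alpha_neq0 fixed unif vE).
split=> //.
- split; [by exists u|by exists v| |].
    exact: (associated_usol alpha_neq0 fixed unif).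
  exact: (associated_vsol alpha_neq0 fixed unif).
- move=> e e01 x; have [M [aM bM]] := fixed e e01.
  apply: cvg_trans (cvg_uexpr_initial (v0 e) alpha_neq0 e01 aM (x := x)).
  apply: near_eq_cvg; rewrite near_withinE; apply: nearW => p pO.
  by rewrite /u uE// inE.
- move=> e e01 x; have [M [aM bM]] := fixed e e01.
  apply: cvg_trans (cvg_vexpr_initial alpha_neq0 e01 aM bM (x := x)).
  apply: near_eq_cvg; rewrite near_withinE; apply: nearW => p pO.
  by rewrite /v vE// inE.
Qed.
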